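(* Let $f(x)=\frac{1}{Mn}\sum_{m\in[M],j\in[n]}f_{m,j}(x)$, $N=Mn$, and let $\mathcal{K}\subseteq\mathbb{R}^d$ be convex and compact with diameter $D=\sup_{x,y\in\mathcal{K}}\|x-y\|$. Assume all $f_{m,j}$ are (possibly non-convex) $L$-smooth on $\mathcal{K}$, $\sup_{x\in\mathcal{K}}|f_{m,j}(x)|\le M_0$, and $\|\nabla f_{m,j}(x)\|_\infty\le G_\infty$ for all $x\in\mathcal{K}$, $m\in[M]$, $j\in[n]$. Run the Quantized Frank-Wolfe (QFW) algorithm described in the context with: $p_i=\sqrt n$; $\mathcal{S}_{i,1}^m=\{f_{m,j}:j\in[n]\}$; $S_{i,k}=\sqrt n/M$ for $i\ge1,k\ge2$; $\eta_t=T^{-1/2}$ for all $t$; and the $s$-Partition Encoding Scheme with levels $s_{1,i,1}=\sqrt{Td/M}$, $s_{2,i,1}=\sqrt{Td}$, and $s_{1,i,k}=\frac{d^{1/2}n^{1/4}}{\sqrt M}$, $s_{2,i,k}=d^{1/2}n^{1/4}$ for $k\ge2$; output $x_o$ chosen uniformly at random from $\{x_1,\dots,x_T\}$. Then the algorithm finds an $\epsilon$-first-order stationary point, i.e. $\mathbb{E}[\mathcal{G}(x_o)]\le\epsilon$ where $\mathcal{G}(x)=\max_{v\in\mathcal{K}}\langle v-x,-\nabla f(x)\rangle$, after at most $T=\mathcal{O}(1/\epsilon^2)$ iterations, and the IFO complexity per worker is $\mathcal{O}\big(\sqrt N/(\epsilon^2\sqrt M)\big)$.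
   Context: $\|\cdot\|$ is the Euclidean norm, $[n]=\{1,\dots,n\}$. There are $M$ workers and a master; worker $m$ has access to the functions $f_{m,j}$, $j\in[n]$. A function is $L$-smooth on $\mathcal{K}$ if its gradient is $L$-Lipschitz on $\mathcal{K}$. The $\mathcal{O}(\cdot)$ is asymptotic as $\epsilon\to0$, with hidden constants depending only on $M_0,L,D,G_\infty$. The IFO complexity per worker is the number of exact component-function gradients computed by one worker: a round with $k=1$ costs $n$ and a round with $k\ge2$ costs $2S_{i,k}$ (nominal sample size $S_{i,k}=\sqrt n/M$). $s$-Partition Encoding Scheme: for $g\in\mathbb{R}^d$ and each coordinate $i$, find $l_i\in\{0,\dots,s-1\}$ with $|g_i|/\|g\|_\infty\in[l_i/s,(l_i+1)/s]$ and let $b_i=l_i/s$ with probability $1-\frac{|g_i|}{\|g\|_\infty}s+l_i$, and $b_i=(l_i+1)/s$ with probability $\frac{|g_i|}{\|g\|_\infty}s-l_i$. The transmitted data are $\mathrm{sign}(g_i)b_i$ and $\|g\|_\infty$; the decoded vector $\phi'(g)$ has coordinates $\mathrm{sign}(g_i)b_i\|g\|_\infty$ (and $\phi'(0)=0$). QFW: starting from $x_1\in\mathcal{K}$, rounds $t=1,\dots,T$ are grouped in consecutive periods of lengths $p_1,p_2,\dots$; round $t$ corresponds to $(i,k)$ with $t=\sum_{j=1}^{i-1}p_j+k$, $1\le k\le p_i$, and $x_{i,k}=x_t$, $\eta_{i,k}=\eta_t$. In round $(i,k)$ each worker $m$ takes a collection $\mathcal{S}_{i,k}^m$ of its local functions;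 for $k\ge2$ it consists of $S_{i,k}$ functions sampled uniformly at random (with replacement) from its $n$ functions. Writing $f_{\mathcal{S}}$ for the average of the functions in $\mathcal{S}$, the worker computes $g_{i,1}^m=\nabla f_{\mathcal{S}_{i,1}^m}(x_t)$ if $k=1$, and $g_{i,k}^m=\nabla f_{\mathcal{S}_{i,k}^m}(x_t)-\nabla f_{\mathcal{S}_{i,k}^m}(x_{t-1})$ if $k\ge2$, and sends it encoded with level $s_{1,i,k}$. The master decodes these to $\Phi_{1,i,k}'(g_{i,k}^m)$, forms $\tilde g_{i,k}=\frac1M\sum_{m=1}^M\Phi_{1,i,k}'(g_{i,k}^m)$, and broadcasts it encoded with level $s_{2,i,k}$; workers decode it to $\Phi_{2,i,k}'(\tilde g_{i,k})$ and set $\bar g_{i,1}=\Phi_{2,i,1}'(\tilde g_{i,1})$ if $k=1$, $\bar g_{i,k}=\Phi_{2,i,k}'(\tilde g_{i,k})+\bar g_{i,k-1}$ if $k\ge2$. Then $v_{i,k}\in\arg\min_{v\in\mathcal{K}}\langle v,\bar g_{i,k}\rangle$ and $x_{t+1}=x_t+\eta_{i,k}(v_{i,k}-x_t)$. All random choices are independent across coordinates, workers and rounds. In the algorithm, period lengths, sample sizes and levels that are not integers are rounded up to the next positive integer. *)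

(* Defs.v *)
From HB Require Import structures.
From mathcomp Require Import all_boot all_order all_algebra.
From mathcomp Require Import all_classical all_reals all_analysis.

Set Implicit Arguments.
Unset Strict Implicit.
Unset Printing Implicit Defensive.

Import Order.TTheory GRing.Theory Num.Theory.
Import numFieldNormedType.Exports.

Local Open Scope classical_set_scope.
Local Open Scope ring_scope.

(* The library norm `|u| of u : 'rV[R]_d is the sup norm, i.e. ||u||_oo; the
   Euclidean norm is enorm. *)
Section Euclidean.
Context {R : realType} {d : nat}.
Implicit Types (u v x : 'rV[R]_d) (K : set 'rV[R]_d) (h : 'rV[R]_d -> R).

Definition dotp u v : R := \sum_(i < d) u 0 i * v 0 i.

Definition enorm u : R := Num.sqrt (dotp u u).

Definition diameter K : R := sup [set enorm (x - y) | x in K & y in K].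

Definition grad h x : 'rV[R]_d := \row_i 'D_(delta_mx 0 i) h x.

Definition smooth_on (L : R) K h : Prop :=
  (forall x, K x -> differentiable h x) /\
  (forall x y, K x -> K y -> enorm (grad h x - grad h y) <= L * enorm (x - y)).

Definition fw_gap K h x : R := sup [set dotp (v - x) (- grad h x) | v in K].

Definition linear_argmin K u : set 'rV[R]_d :=
  [set v | K v /\ forall w, K w -> dotp v u <= dotp w u].

Definition fmean (q : nat) (F : 'I_q -> 'rV[R]_d -> R) : 'rV[R]_d -> R :=
  fun x => q%:R^-1 * \sum_(r < q) F r x.

End Euclidean.

Definition round_up {R : realType} (a : R) : nat := maxn 1 `|Num.ceil a|%N.

(* s-Partition Encoding Scheme. The choice between the two admissible levels
   when a is a multiple of 1/s does not affect the law of the decoded vector.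
   For g = 0, x / 0 = 0 makes the level 0, and the decoded vector is 0. *)
Section Partition.
Context {R : realType} {d : nat}.
Implicit Types (s : nat) (g : 'rV[R]_d) (i : 'I_d).

Definition level s (a : R) : nat :=
  if [pick l : 'I_s | l%:R / s%:R <= a <= l.+1%:R / s%:R] is Some l
  then l else 0%N.

Definition ratio g i : R := `|g 0 i| / `|g|.

(* b = true means that the ratio is rounded to (l + 1) / s, b = false that it
   is rounded to l / s. *)
Definition bit_prob s g i (b : bool) : R :=
  if b then ratio g i * s%:R - (level s (ratio g i))%:R
  else 1 - ratio g i * s%:R + (level s (ratio g i))%:R.

Definition decode s g (b : 'I_d -> bool) : 'rV[R]_d :=
  \row_i (Num.sg (g 0 i) * ((level s (ratio g i) + b i)%:R / s%:R) * `|g|).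

End Partition.

(* Rounds are numbered from 0: round t here is round t + 1 of the usual 1-based
   numbering, x 0 is the starting point, and with a constant period length p a
   period starts (k = 1) at the rounds t divisible by p. *)
Section QFW.
Context {R : realType} {M n d : nat}.
Variables (K : set 'rV[R]_d) (f : 'I_M -> 'I_n -> 'rV[R]_d -> R).

Definition objective : 'rV[R]_d -> R :=
  fun x => (M * n)%:R^-1 * \sum_(m < M) \sum_(j < n) f m j x.

Variables (T p S : nat) (eta : nat -> R) (s1 s2 : nat -> nat).

(* The random choices of one round: the indices sampled by each worker, the
   rounding bits of each worker, and the rounding bits of the master. *)
Definition choices : Type :=
  ({ffun 'I_M * 'I_S -> 'I_n} * {ffun 'I_M * 'I_d -> bool}
   * {ffun 'I_d -> bool})%type.
Definition sample (w : choices) (m : 'I_M) (r : 'I_S) : 'I_n := w.1.1 (m, r).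
Definition worker_bits (w : choices) (m : 'I_M) (i : 'I_d) : bool :=
  w.1.2 (m, i).
Definition master_bits (w : choices) (i : 'I_d) : bool := w.2 i.

(* The samples are drawn, but not used, when k = 1. *)
Definition worker_vec (t : nat) (x : nat -> 'rV[R]_d) (w : choices)
    (m : 'I_M) : 'rV[R]_d :=
  if (p %| t)%N then grad (fmean (f m)) (x t)
  else let fS := fmean (fun r : 'I_S => f m (sample w m r)) in
       grad fS (x t) - grad fS (x t.-1).

Definition master_vec (t : nat) (x : nat -> 'rV[R]_d) (w : choices) :
    'rV[R]_d :=
  M%:R^-1 *: \sum_(m < M) decode (s1 t) (worker_vec t x w m) (worker_bits w m).

(* The probability of w in round t given the iterates up to x t. *)
Definition choices_prob (t : nat) (x : nat -> 'rV[R]_d) (w : choices) : R :=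
  (\prod_(m < M) \prod_(r < S) n%:R^-1)
  * (\prod_(m < M) \prod_(i < d)
       bit_prob (s1 t) (worker_vec t x w m) i (worker_bits w m i))
  * \prod_(i < d) bit_prob (s2 t) (master_vec t x w) i (master_bits w i).

Section Run.
Context {disp : measure_display} {Omega : measurableType disp}.
Variables (P : probability Omega R) (x1 : 'rV[R]_d).
Variables (W : nat -> Omega -> choices) (x gbar v : nat -> Omega -> 'rV[R]_d).
Variable out : Omega -> 'I_T.

(* The event that the choices in the rounds before t are those made at om. *)
Definition past (t : nat) (om : Omega) : set Omega :=
  [set om' | forall u, (u < t)%N -> W u om' = W u om].

(* The choices are discrete, so their joint law (independent samples, and
   independent rounding bits given the vectors to encode) is given by the
   conditional probabilities of the choices of each round given the past. The
   minimizers v are arbitrary but may not look into the future. *)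
Record qfw_run : Prop := QFWRun {
  qfw_measurable_choices : forall t w, (t < T)%N ->
    measurable [set om | W t om = w];
  qfw_measurable_out : forall o, measurable [set om | out om = o];
  qfw_choices_law : forall t om, (t < T)%N ->
    P (past t.+1 om)
    = (P (past t om) * (choices_prob t (x ^~ om) (W t om))%:E)%E;
  qfw_out_law : forall om o,
    P (past T om `&` [set om' | out om' = o])
    = (P (past T om) * (T%:R^-1)%:E)%E;
  qfw_start : forall om, x 0%N om = x1;
  qfw_gbar : forall t om, (t < T)%N ->
    gbar t om =
      decode (s2 t) (master_vec t (x ^~ om) (W t om)) (master_bits (W t om))
      + (if (p %| t)%N then 0 else gbar t.-1 om);
  qfw_argmin : forall t om, (t < T)%N -> linear_argmin K (gbar t om) (v t om);
  qfw_nonanticipating : forall t om om', (t < T)%N ->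
    past t.+1 om om' -> v t om' = v t om;
  qfw_step : forall t om, (t < T)%N ->
    x t.+1 om = x t om + eta t *: (v t om - x t om)
}.

End Run.

End QFW.

(* Exact component gradients computed by one worker in T rounds. *)
Definition ifo_per_worker {R : realType} (M n p T : nat) : R :=
  \sum_(t < T)
    (if (p %| t)%N then n%:R else 2 * (Num.sqrt n%:R / M%:R)).

(* Main.v *)
Require Import Defs.
From HB Require Import structures.
From mathcomp Require Import all_boot all_order all_algebra.
From mathcomp Require Import all_classical all_reals all_analysis.
From mathcomp Require Import measurable_realfun.
From mathcomp Require Import ring lra.

Set Implicit Arguments.
Unset Strict Implicit.
Unset Printing Implicit Defensive.

Import Order.TTheory GRing.Theory Num.Theory.
Import numFieldNormedType.Exports.

Local Open Scope classical_set_scope.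
Local Open Scope ring_scope.

(** The proof has a deterministic half and a probabilistic half.

    Deterministic: a Frank-Wolfe step along the minimizer v of the estimate gb
    decreases the objective F by eta times the gap, up to a term of order
    L eta^2 D^2 and the inner product of the error gb - grad F with a vector of
    length at most D (fw_step). Summing over T rounds telescopes F, which is
    bounded by M0. With eta = T^(-1/2) the average gap is O(T^(-1/2)) as soon as
    the squared error of the estimate is O(1/T) in expectation; Young's
    inequality turns the inner product into squared norms, so that only second
    moments of the error ever occur.

    Probabilistic: the partition encoding is unbiased, and the variance of each
    coordinate is at most the squared sup norm over the squared level
    (decode_coord_mean, decode_coord_variance). All bits and samples of a round
    are independent, so that variances add up (product_law_dotp_sum); averaging
    over workers and samples divides them by M and M S. At the start of a period
    full gradients bounded by Ginf are encoded, and the levels (T d / M)^(1/2)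
    and (T d)^(1/2) leave a squared error 2 Ginf^2 / T (round_start). Inside a
    period only differences of gradients at consecutive iterates are encoded;
    their norm is at most L D T^(-1/2) by smoothness, and the three sources of
    noise (samples, worker bits, master bits) contribute L^2 D^2 / (T n^(1/2))
    each (round_update). This noise is centred given the past, hence orthogonal
    to the error already accumulated, and squared errors just add up over the
    at most 2 n^(1/2) rounds of a period (error_update, error_bound). The total
    is 2 Ginf^2 / T + 6 L^2 D^2 / T.

    To condition on the past, expectations are written as finite sums over
    histories of choices. Everything except the output index is a function of
    the history, and history_mean_tower integrates out the last round with the
    transition probabilities. *)

(** * Euclidean geometry and smooth functions *)

Section EuclideanTheory.
Context {R : realType} {d : nat}.
Implicit Types (u v w : 'rV[R]_d) (a : R).

Lemma dotpC u v : dotp u v = dotp v u.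
Proof. by apply: eq_bigr => i _; rewrite mulrC. Qed.

Lemma dotpDl u v w : dotp (u + v) w = dotp u w + dotp v w.
Proof. by rewrite -big_split; apply: eq_bigr => i _; rewrite mxE mulrDl. Qed.

Lemma dotpDr u v w : dotp w (u + v) = dotp w u + dotp w v.
Proof. by rewrite dotpC dotpDl !(dotpC w). Qed.

Lemma dotpZl a u v : dotp (a *: u) v = a * dotp u v.
Proof. by rewrite mulr_sumr; apply: eq_bigr => i _; rewrite mxE mulrA. Qed.

Lemma dotpZr a u v : dotp v (a *: u) = a * dotp v u.
Proof. by rewrite dotpC dotpZl dotpC. Qed.

Lemma dotpNl u v : dotp (- u) v = - dotp u v.
Proof. by rewrite -scaleN1r dotpZl mulN1r. Qed.

Lemma dotpNr u v : dotp u (- v) = - dotp u v.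
Proof. by rewrite dotpC dotpNl dotpC. Qed.

Lemma dotp0r u : dotp u 0 = 0.
Proof. by rewrite -(scale0r 0) dotpZr mul0r. Qed.

Lemma dotp_sumr (I : finType) (F : I -> 'rV[R]_d) u :
  dotp u (\sum_i F i) = \sum_i dotp u (F i).
Proof.
by elim/big_rec2: _ => [|i y1 y2 _ <-]; rewrite ?dotp0r// dotpDr.
Qed.

Lemma dotp_ge0 u : 0 <= dotp u u.
Proof. by apply: sumr_ge0 => i _; rewrite -expr2 sqr_ge0. Qed.

Lemma enorm_sqr u : enorm u ^+ 2 = dotp u u.
Proof. by rewrite sqr_sqrtr// dotp_ge0. Qed.

Lemma enorm_ge0 u : 0 <= enorm u.
Proof. exact: sqrtr_ge0. Qed.

(** Young's inequality. It takes the place of Cauchy-Schwarz, so that only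
    squared Euclidean norms, which average well, need to be handled. *)
Lemma dotp_young a u v : 0 < a ->
  2 * dotp u v <= a * dotp u u + a^-1 * dotp v v.
Proof.
move=> a0; have := dotp_ge0 (a *: u - v).
rewrite dotpDl !dotpDr !dotpNl !dotpNr !dotpZl !dotpZr opprK (dotpC v u) => h.
rewrite -(ler_pM2l a0) mulrDr (mulrA a a^-1) divff ?gt_eqF// mul1r -subr_ge0.
by apply: le_trans h _; rewrite le_eqVlt; apply/orP; left; apply/eqP; ring.
Qed.

Lemma normr_coord_le u i : `|u 0 i| <= `|u|.
Proof.
by rewrite [leRHS]/Num.norm /= mx_normrE; apply/bigmax_geP; right => /=; exists (0, i).
Qed.

Lemma rV_norm_le u a : 0 <= a -> (forall i, `|u 0 i| <= a) -> `|u| <= a.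
Proof.
move=> a0 h; rewrite [leLHS]/Num.norm /= mx_normrE; apply/bigmax_leP; split=> //.
by case=> i j _ /=; rewrite ord1.
Qed.

Lemma sqr_coord_le_dotp u i : u 0 i ^+ 2 <= dotp u u.
Proof.
rewrite /dotp (bigD1 i)//= -expr2 lerDl; apply: sumr_ge0 => j _.
by rewrite -expr2 sqr_ge0.
Qed.

Lemma sqr_norm_le_dotp u : `|u| ^+ 2 <= dotp u u.
Proof.
rewrite -enorm_sqr lerXn2r ?nnegrE ?enorm_ge0//.
apply: rV_norm_le; first exact: enorm_ge0.
by move=> i; rewrite -sqrtr_sqr ler_sqrt ?dotp_ge0// sqr_coord_le_dotp.
Qed.

Lemma dotp_le_norm u : dotp u u <= d%:R * `|u| ^+ 2.
Proof.
rewrite mulr_natl -[X in _ *+ X]card_ord -sumr_const; apply: ler_sum => i _.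
by rewrite -expr2 -[leLHS]real_normK ?num_real// lerXn2r ?nnegrE ?normr_coord_le.
Qed.

Lemma compact_dist_le_diameter (K : set 'rV[R]_d) u v :
  compact K -> K u -> K v -> dotp (u - v) (u - v) <= diameter K ^+ 2.
Proof.
move=> /compact_bounded[B [Breal KB]] Ku Kv.
have B1 w : K w -> `|w| <= B + 1 by apply: KB; rewrite ltrDl.
have le_diam : enorm (u - v) <= diameter K.
  apply: ub_le_sup; last by exists u => //; exists v.
  exists (Num.sqrt (d%:R * (2 * (B + 1)) ^+ 2)) => _ /= [w Kw [z Kz <-]].
  rewrite ler_sqrt; last by rewrite mulr_ge0 ?sqr_ge0.
  apply: le_trans (dotp_le_norm _) _; rewrite ler_wpM2l// lerXn2r ?nnegrE//.
    by apply: mulr_ge0 => //; apply: le_trans (B1 _ Kw).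
  by apply: le_trans (ler_normB _ _) _; rewrite mulrDl mul1r lerD ?B1.
rewrite -enorm_sqr lerXn2r ?nnegrE ?enorm_ge0//.
exact: le_trans (enorm_ge0 _) le_diam.
Qed.

Lemma average_norm_le q (v : 'I_q -> 'rV[R]_d) (B : R) : (0 < q)%N ->
  (forall r, `|v r| <= B) -> `|q%:R^-1 *: \sum_r v r| <= B.
Proof.
move=> q0 hv; rewrite normrZ ger0_norm ?invr_ge0// ler_pdivrMl ?ltr0n//.
apply: le_trans (ler_norm_sum _ _ _) _; rewrite mulr_natl -[X in _ *+ X]card_ord.
by rewrite -sumr_const; exact: ler_sum.
Qed.

End EuclideanTheory.

Section Smoothness.
Context {R : realType} {d : nat}.
Implicit Types (K : set 'rV[R]_d) (h : 'rV[R]_d -> R) (x y v : 'rV[R]_d) (L : R).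

Lemma derive_dotp_grad h x v : differentiable h x ->
  'D_v h x = dotp v (grad h x).
Proof.
move=> dh; rewrite deriveE// {1}(row_sum_delta v) linear_sum /=.
by apply: eq_bigr => i _; rewrite linearZ/= mxE deriveE.
Qed.

Lemma differentiable_fmean q (F : 'I_q -> 'rV[R]_d -> R) x :
  (forall r, differentiable (F r) x) -> differentiable (fmean F) x.
Proof.
move=> dF; have -> : fmean F = q%:R^-1 \*: (\sum_r F r).
  by apply/funext => y; rewrite /fmean fct_sumE.
by apply: differentiableZ; apply: differentiable_sum.
Qed.

Lemma grad_fmean q (F : 'I_q -> 'rV[R]_d -> R) x :
  (forall r, differentiable (F r) x) ->
  grad (fmean F) x = q%:R^-1 *: \sum_r grad (F r) x.
Proof.
move=> dF; have -> : fmean F = q%:R^-1 \*: (\sum_r F r).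
  by apply/funext => y; rewrite /fmean fct_sumE.
apply/rowP => i; rewrite !mxE deriveZ; last first.
  by apply: diff_derivable; apply: differentiable_sum.
rewrite derive_sum; last by move=> r; apply: diff_derivable.
by rewrite summxE; congr (_ * _); apply: eq_bigr => r _; rewrite mxE.
Qed.

Lemma convex_segment K x y (a : R) : convex_set K -> K x -> K y ->
  0 <= a <= 1 -> K (x + a *: (y - x)).
Proof.
move=> Kc /mem_set Kx /mem_set Ky a01.
have [a0 a1] := andP a01.
have ai : Itv.spec (@Itv.num_sem R) (Itv.Real `[0%Z, 1%Z]) a.
  by rewrite /= /Itv.num_sem /= num_real /= in_itv /= a0 a1.
have Ky' : K (a *: y + (1 - a) *: x) := set_mem (Kc y x (Itv.mk ai) Ky Kx).
rewrite (_ : x + _ = a *: y + (1 - a) *: x)//.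
by rewrite scalerBr scalerBl scale1r addrCA addrA -addrA.
Qed.

Lemma smooth_on_pos L K h : smooth_on L K h -> smooth_on (`|L| + 1) K h.
Proof.
move=> [dh Lh]; split=> // x y Kx Ky; apply: le_trans (Lh _ _ Kx Ky) _.
by rewrite ler_wpM2r ?enorm_ge0// (le_trans (ler_norm _))// lerDl.
Qed.

Lemma smooth_on_dotp L K h x y : 0 <= L -> smooth_on L K h -> K x -> K y ->
  dotp (grad h x - grad h y) (grad h x - grad h y)
  <= L ^+ 2 * dotp (x - y) (x - y).
Proof.
move=> L0 [_ Lh] Kx Ky; rewrite -!enorm_sqr -exprMn.
by rewrite lerXn2r ?nnegrE ?mulr_ge0 ?enorm_ge0 ?Lh.
Qed.

(** Descent inequality: the mean value theorem on the segment from x to y turns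
    the increment of h into a directional derivative at an intermediate point,
    whose gradient is within L times the length of the segment of the gradient
    at x. *)
Lemma smooth_descent L K h x y : 0 < L -> convex_set K -> smooth_on L K h ->
  K x -> K y ->
  h y <= h x + dotp (y - x) (grad h x) + L * dotp (y - x) (y - x).
Proof.
move=> L0 Kc hL Kx Ky.
pose z (a : R) := x + a *: (y - x).
have Kz (a : R) : 0 <= a <= 1 -> K (z a) by exact: convex_segment.
have dz (a : R) : is_diff a z ( *:%R ^~ (y - x)).
  by apply: is_diff_eq; rewrite add0r.
have dhz (a : R) : 0 <= a <= 1 -> differentiable (h \o z) a.
  move=> a01; apply: differentiable_comp; first by apply: ex_diff; exact: dz.
  by apply: hL.1; apply: Kz.
have dhzE (a : R) : 0 <= a <= 1 ->
    is_derive a 1 (h \o z) (dotp (y - x) (grad h (z a))).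
  move=> a01; apply: DeriveDef; first exact/diff_derivable/dhz.
  rewrite deriveE; last exact: dhz.
  rewrite diff_comp /=; [|by apply: ex_diff; exact: dz|by apply: hL.1; apply: Kz].
  have dza := dz a; rewrite diff_val scale1r -deriveE; last by apply: hL.1; apply: Kz.
  by rewrite derive_dotp_grad//; apply: hL.1; apply: Kz.
have [c| |c /andP[c0 c1]] :=
  @MVT R (h \o z) (fun a => dotp (y - x) (grad h (z a))) 0 1 ltr01.
- by rewrite in_itv /= => /andP[c0 c1]; apply: dhzE; rewrite !ltW.
- apply: continuous_in_subspaceT => a /[!inE] /=; rewrite in_itv /= => a01.
  exact/differentiable_continuous/dhz.
rewrite subr0 mulr1 /= /z scale0r addr0 scale1r subrKC => hE.
set g := grad h (x + c *: (y - x)) in hE *.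
have -> : h y = h x + dotp (y - x) (grad h x) + dotp (y - x) (g - grad h x).
  by rewrite dotpDr dotpNr addrACA subrr addr0 -hE subrKC.
rewrite lerD2l; set q := dotp (y - x) (y - x).
have gq : dotp (g - grad h x) (g - grad h x) <= L ^+ 2 * q.
  apply: le_trans (smooth_on_dotp (ltW L0) hL (Kz c _) Kx) _.
    by rewrite !ltW.
  rewrite ler_wpM2l ?sqr_ge0// addrC addKr dotpZl dotpZr mulrA -expr2 -/q.
  by rewrite ler_piMl ?dotp_ge0// expr_le1// ltW.
have := dotp_young (y - x) (g - grad h x) L0; rewrite -/q => hyoung.
have : L^-1 * dotp (g - grad h x) (g - grad h x) <= L * q.
  rewrite ler_pdivrMl// mulrA -expr2; exact: gq.
by move: hyoung; lra.
Qed.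

End Smoothness.

(** * Second moments under a finite product law *)

Section ProductLaw.
Context {R : realType} {J A : finType}.
Implicit Types (mu : J -> A -> R).

Definition product_law mu (a : {ffun J -> A}) : R := \prod_j mu j (a j).

(** Expanding the product of the sums over b gives one term per function a. *)
Lemma product_law_prod mu (G : J -> A -> R) :
  \sum_a product_law mu a * \prod_j G j (a j)
  = \prod_j \sum_b mu j b * G j b.
Proof. by rewrite bigA_distr_bigA; apply: eq_bigr => a _; rewrite big_split. Qed.

Variable mu : J -> A -> R.
Hypothesis mu1 : forall j, \sum_b mu j b = 1.

Lemma product_law_sum1 : \sum_a product_law mu a = 1.
Proof.
rewrite -[RHS](big1 (R := R) (idx := 1) (op := *%R) (index_enum J) xpredT (fun=> 1))//.
rewrite -[RHS](eq_bigr _ (fun j _ => mu1 j)) bigA_distr_bigA; exact: eq_bigr.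
Qed.

Lemma product_law_marginal j (g : A -> R) :
  \sum_a product_law mu a * g (a j) = \sum_b mu j b * g b.
Proof.
transitivity (\sum_a product_law mu a * \prod_i (if i == j then g (a i) else 1)).
  apply: eq_bigr => a _; rewrite (bigD1 j)//= eqxx big1 ?mulr1// => i /negbTE->.
  by [].
rewrite (product_law_prod mu (fun i b => if i == j then g b else 1)).
rewrite (bigD1 j)//= eqxx [X in _ * X]big1 ?mulr1// => i /negbTE->.
by under eq_bigr do rewrite mulr1; exact: mu1.
Qed.

Lemma product_law_independent j k (g h : A -> R) : j != k ->
  \sum_a product_law mu a * (g (a j) * h (a k))
  = (\sum_b mu j b * g b) * (\sum_b mu k b * h b).
Proof.
move=> jk; have kj : k == j = false by rewrite eq_sym (negbTE jk).
pose G i b := if i == j then g b else if i == k then h b else 1.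
transitivity (\sum_a product_law mu a * \prod_i G i (a i)).
  apply: eq_bigr => a _; rewrite (bigD1 j)//= (bigD1 k) /=; last by rewrite kj.
  rewrite big1 ?mulr1 /G ?kj ?eqxx// => i /andP[/negbTE-> /negbTE->].
  by [].
rewrite product_law_prod (bigD1 j)//= (bigD1 k) /=; last by rewrite kj.
rewrite [X in _ * (_ * X)]big1 ?mulr1 /G ?kj ?eqxx// => i /andP[/negbTE-> /negbTE->].
by under eq_bigr do rewrite mulr1; exact: mu1.
Qed.

Lemma product_law_cst (c : R) : \sum_a product_law mu a * c = c.
Proof. by rewrite -mulr_suml product_law_sum1 mul1r. Qed.

(** Bias-variance decomposition: independence kills the cross terms, so the
    variances of the summands add up. *)
Lemma product_law_sqr_sum (Y : J -> A -> R) (u : R) :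
  let m j := \sum_b mu j b * Y j b in
  \sum_a product_law mu a * (u + \sum_j Y j (a j)) ^+ 2
  = (u + \sum_j m j) ^+ 2 + \sum_j (\sum_b mu j b * Y j b ^+ 2 - m j ^+ 2).
Proof.
move=> m; pose Z j b := Y j b - m j.
have Z0 j : \sum_b mu j b * Z j b = 0.
  under eq_bigr do rewrite mulrBr.
  by rewrite sumrB -mulr_suml mu1 mul1r subrr.
have Z2 j : \sum_b mu j b * (Z j b * Z j b) = \sum_b mu j b * Y j b ^+ 2 - m j ^+ 2.
  transitivity (\sum_b (mu j b * Y j b ^+ 2
                        + ((mu j b * Y j b) * (- (2 * m j)) + mu j b * m j ^+ 2))).
    by apply: eq_bigr => b _; rewrite /Z; ring.
  by rewrite !big_split /= -!mulr_suml mu1 -/(m j); ring.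
pose c := u + \sum_j m j.
transitivity (\sum_a (product_law mu a * c ^+ 2
  + (\sum_j product_law mu a * Z j (a j) * (2 * c)
     + \sum_j \sum_k product_law mu a * (Z j (a j) * Z k (a k))))).
  apply: eq_bigr => a _.
  have -> : u + \sum_j Y j (a j) = c + \sum_j Z j (a j).
    by rewrite /Z sumrB /c addrACA subrr addr0.
  rewrite -mulr_suml -mulr_sumr.
  under [X in _ + (_ + X)]eq_bigr do rewrite -mulr_sumr -mulr_sumr.
  by rewrite -mulr_sumr -mulr_suml; ring.
rewrite big_split /= product_law_cst -/c; congr (_ + _).
rewrite big_split /= exchange_big /= big1 ?add0r; last first.
  by move=> j _; rewrite -mulr_suml product_law_marginal Z0 mul0r.
rewrite exchange_big /=; apply: eq_bigr => j _; rewrite -Z2.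
rewrite exchange_big /= (bigD1 j)//= [X in _ + X]big1 ?addr0; last first.
  by move=> k kj; rewrite product_law_independent 1?eq_sym// Z0 mul0r.
by rewrite (product_law_marginal j (fun b => Z j b * Z j b)).
Qed.

Lemma product_law_dotp_sum d (X : J -> A -> 'rV[R]_d) (u : 'rV[R]_d) :
  let m j := \sum_b mu j b *: X j b in
  let z a := u + \sum_j X j (a j) in
  \sum_a product_law mu a * dotp (z a) (z a)
  = dotp (u + \sum_j m j) (u + \sum_j m j)
    + \sum_j (\sum_b mu j b * dotp (X j b) (X j b) - dotp (m j) (m j)).
Proof.
move=> m z.
transitivity (\sum_(i < d) \sum_a product_law mu a
                * (u 0 i + \sum_j X j (a j) 0 i) ^+ 2).
  rewrite exchange_big /=; apply: eq_bigr => a _; rewrite mulr_sumr.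
  by apply: eq_bigr => i _; rewrite -expr2 /z mxE summxE.
under eq_bigr do rewrite (product_law_sqr_sum (fun j b => X j b 0 _)).
have mE j i : m j 0 i = \sum_b mu j b * X j b 0 i.
  by rewrite summxE; apply: eq_bigr => b _; rewrite mxE.
rewrite big_split /=; congr (_ + _).
  apply: eq_bigr => i _; rewrite mxE summxE -expr2.
  by under [in RHS]eq_bigr do rewrite mE.
rewrite exchange_big /=; apply: eq_bigr => j _; rewrite sumrB; congr (_ - _).
  rewrite exchange_big; apply: eq_bigr => b _; rewrite mulr_sumr.
  by apply: eq_bigr => i _; rewrite expr2.
by apply: eq_bigr => i _; rewrite mE expr2.
Qed.

End ProductLaw.

(** * Moments of the partition encoding *)

(* Both names are also exported by the libraries above. *)
Local Notation ratio := Defs.ratio.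
Local Notation decode := Defs.decode.

Section PartitionMoments.
Context {R : realType} {d : nat}.
Implicit Types (s : nat) (g : 'rV[R]_d) (i : 'I_d).

Lemma ratio_itv g i : 0 <= ratio g i <= 1.
Proof.
rewrite /ratio divr_ge0//=; have [->|g0] := eqVneq `|g| 0.
  by rewrite invr0 mulr0.
by rewrite ler_pdivrMr ?lt0r ?g0//= mul1r normr_coord_le.
Qed.

Lemma sg_ratioE g i : Num.sg (g 0 i) * ratio g i * `|g| = g 0 i.
Proof.
rewrite /ratio mulrA -numEsg; have [g0|g0] := eqVneq `|g| 0; last by rewrite divfK.
rewrite g0 mulr0; apply/esym/eqP; rewrite -normr_eq0 eq_le normr_ge0 andbT.
by rewrite -g0 normr_coord_le.
Qed.

(** For a in [0, 1] some cell always contains a, so the default value of level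
    is not reached; the right end a = 1 falls in the last cell, whence the
    minimum with s - 1 in the proof. *)
Lemma levelP s (a : R) : (0 < s)%N -> 0 <= a <= 1 ->
  (level s a < s)%N /\ (level s a)%:R <= a * s%:R <= (level s a).+1%:R.
Proof.
move=> s0 /andP[a0 a1]; have sR : 0 < s%:R :> R by rewrite ltr0n.
rewrite /level; case: pickP => [l|/(_ _) none].
  by rewrite ler_pdivrMr// ler_pdivlMr// => la; split.
exfalso; have as0 : 0 <= a * s%:R by rewrite mulr_ge0.
have as1 : a * s%:R <= s%:R by rewrite ler_piMl ?ler0n.
pose k := minn (Num.truncn (a * s%:R)) s.-1.
have ks : (k < s)%N by rewrite /k (leq_ltn_trans (geq_minr _ _))// prednK.
have := none (Ordinal ks); rewrite /= ler_pdivrMr// ler_pdivlMr// => /negP; apply.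
have /andP[t1 t2] := truncn_itv as0; rewrite /k; apply/andP; split.
  by apply: le_trans t1; rewrite ler_nat geq_minl.
rewrite /minn; case: ifP => _; first exact: ltW.
by rewrite prednK.
Qed.

Lemma bit_prob_ge0 s g i b : (0 < s)%N -> 0 <= bit_prob s g i b.
Proof.
move=> s0; have [_ /andP[l1 l2]] := levelP s0 (ratio_itv g i).
rewrite /bit_prob; case: b; first by rewrite subr_ge0.
by rewrite addrAC subr_ge0 addrC natr1.
Qed.

Lemma bit_prob_sum1 s g i : \sum_b bit_prob s g i b = 1.
Proof. by rewrite big_bool /bit_prob /=; ring. Qed.

Definition decode_coord s g i (b : bool) : R :=
  Num.sg (g 0 i) * ((level s (ratio g i) + b)%:R / s%:R) * `|g|.

Lemma decode_sumE s g b :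
  decode s g b = \sum_i decode_coord s g i (b i) *: delta_mx 0 i.
Proof. by rewrite {1}(row_sum_delta (decode s g b)); under eq_bigr do rewrite mxE. Qed.

Lemma decode_coord_mean s g i : (0 < s)%N ->
  \sum_b bit_prob s g i b * decode_coord s g i b = g 0 i.
Proof.
move=> s0; have sR : s%:R != 0 :> R by rewrite pnatr_eq0 -lt0n.
rewrite -[RHS]sg_ratioE big_bool /bit_prob /decode_coord /= addn0 natrD.
by field.
Qed.

(** The rounding stays inside one cell, whose width is the sup norm of g over s
    once the decoding has rescaled it. With th the relative position in the
    cell, the variance is th (1 - th) times the squared width. *)
Lemma decode_coord_variance s g i : (0 < s)%N ->
  \sum_b bit_prob s g i b * decode_coord s g i b ^+ 2 - g 0 i ^+ 2
  <= `|g| ^+ 2 / s%:R ^+ 2.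
Proof.
move=> s0; have sR : s%:R != 0 :> R by rewrite pnatr_eq0 -lt0n.
have [_ /andP[l1 l2]] := levelP s0 (ratio_itv g i).
rewrite -[X in _ - X ^+ 2]sg_ratioE big_bool /bit_prob /decode_coord /= addn0 natrD.
set l : R := (level _ _)%:R in l1 l2 *.
have l2' : ratio g i * s%:R <= l + 1 by rewrite natr1.
pose th := ratio g i * s%:R - l.
have th01 : th * (1 - th) <= 1 by rewrite /th; nra.
apply: (@le_trans _ _ ((Num.sg (g 0 i)) ^+ 2 * (th * (1 - th))
   * (`|g| ^+ 2 / s%:R ^+ 2))).
  by rewrite le_eqVlt; apply/orP; left; apply/eqP; rewrite /th; field.
rewrite ler_piMl ?divr_ge0 ?sqr_ge0//; rewrite sqr_sg.
by case: (_ != 0); rewrite ?mul1r ?mul0r.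
Qed.

Lemma norm_decode_le s g b : (0 < s)%N -> `|decode s g b| <= `|g|.
Proof.
move=> s0; have sR : 0 < s%:R :> R by rewrite ltr0n.
apply: rV_norm_le => // i; rewrite mxE !normrM normr_sg normr_id.
have [ls _] := levelP s0 (ratio_itv g i).
rewrite ler_piMl// mulr_ile1 ?mulr_ge0//; first by case: (_ != 0).
rewrite ger0_norm// normfV ger0_norm// ler_pdivrMr// mul1r ler_nat.
by case: (b i); rewrite ?addn1 ?addn0// ltnW.
Qed.

End PartitionMoments.

(** * The error made in one round *)

Section Round.
Context {R : realType} {M n d S : nat}.
Hypotheses (M0 : (0 < M)%N) (n0 : (0 < n)%N) (S0 : (0 < S)%N).
Implicit Types (u : 'rV[R]_d) (B : R).

(** The bits of all workers and those of the master are both covered: j ranges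
    over the transmitted coordinates, the one for j being coordinate k j of the
    vector h j, and a is the weight of the average. Summing squared norms over
    the coordinates turns the scalar variance bound into one per bit. *)
Lemma quantized_sum (J : finType) s (h : J -> 'rV[R]_d) (k : J -> 'I_d)
    (a B : R) u : (0 < s)%N -> (forall j, `|h j| <= B) ->
  let z (b : {ffun J -> bool}) :=
    u + \sum_j (a * decode_coord s (h j) (k j) (b j)) *: delta_mx 0 (k j) in
  let mu j b := bit_prob s (h j) (k j) b in
  let c := u + \sum_j (a * h j 0 (k j)) *: delta_mx 0 (k j) in
  is_true (\sum_b product_law mu b * dotp (z b) (z b)
           <= dotp c c + #|J|%:R * (a ^+ 2 * (B ^+ 2 / s%:R ^+ 2))).
Proof.
move=> s0 hB z mu c.
pose X j b : 'rV[R]_d := (a * decode_coord s (h j) (k j) b) *: delta_mx 0 (k j).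
have delta2 i : dotp (delta_mx 0 i) (delta_mx 0 i : 'rV[R]_d) = 1.
  rewrite /dotp (bigD1 i)//= mxE !eqxx mulr1 big1 ?addr0// => j /negbTE ji.
  by rewrite mxE ji andbF mulr0.
have mX j : \sum_b mu j b *: X j b = (a * h j 0 (k j)) *: delta_mx 0 (k j).
  under eq_bigr do rewrite /X scalerA mulrCA -scalerA.
  by rewrite -scaler_sumr -scaler_suml decode_coord_mean// scalerA.
rewrite (product_law_dotp_sum (fun j => bit_prob_sum1 s (h j) (k j)) X u).
under eq_bigr do rewrite mX; rewrite lerD2l mulr_natl -sumr_const.
apply: ler_sum => j _; rewrite mX.
under eq_bigr do rewrite dotpZl dotpZr delta2 mulr1 -expr2 exprMn mulrCA.
rewrite -mulr_sumr dotpZl dotpZr delta2 mulr1 -expr2 exprMn -mulrBr.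
rewrite ler_wpM2l ?sqr_ge0//; apply: le_trans (decode_coord_variance _ _ s0) _.
by rewrite ler_wpM2r ?invr_ge0 ?sqr_ge0// lerXn2r ?nnegrE// (le_trans _ (hB j)).
Qed.

Lemma quantized_vector s g B u : (0 < s)%N -> `|g| <= B ->
  \sum_(b : {ffun 'I_d -> bool}) (\prod_(i < d) bit_prob s g i (b i))
     * dotp (u + decode s g b) (u + decode s g b)
  <= dotp (u + g) (u + g) + d%:R * (B ^+ 2 / s%:R ^+ 2).
Proof.
move=> s0 gB; have := @quantized_sum _ s (fun=> g) id 1 B u s0 (fun=> gB).
rewrite expr1n mul1r card_ord; under [in X in _ <= X -> _]eq_bigr do rewrite mul1r.
rewrite -row_sum_delta; apply: le_trans; rewrite le_eqVlt; apply/orP; left.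
apply/eqP/eq_bigr => b _; rewrite decode_sumE.
by under [in RHS]eq_bigr do rewrite mul1r.
Qed.

(** The M d variances enter with weight 1 / M^2, which leaves d / M of them. *)
Lemma quantized_average s (g : 'I_M -> 'rV[R]_d) B u :
  (0 < s)%N -> (forall m, `|g m| <= B) ->
  let avg (b : {ffun 'I_M * 'I_d -> bool}) :=
    M%:R^-1 *: \sum_m decode s (g m) (fun i => b (m, i)) in
  let c := u + M%:R^-1 *: \sum_m g m in
  is_true (
    \sum_(b : {ffun 'I_M * 'I_d -> bool})
       (\prod_(m < M) \prod_(i < d) bit_prob s (g m) i (b (m, i)))
       * dotp (u + avg b) (u + avg b)
    <= dotp c c + d%:R * (B ^+ 2 / (M%:R * s%:R ^+ 2))).
Proof.
move=> s0 gB avg c.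
have := @quantized_sum ('I_M * 'I_d)%type s (fun q => g q.1) snd M%:R^-1 B u s0
  (fun q => gB q.1).
have scaleE (G : 'I_M -> 'I_d -> R) :
    \sum_(q : 'I_M * 'I_d) (M%:R^-1 * G q.1 q.2) *: delta_mx 0 q.2
    = M%:R^-1 *: \sum_m \sum_i G m i *: (delta_mx 0 i : 'rV[R]_d).
  rewrite scaler_sumr; under [RHS]eq_bigr do rewrite scaler_sumr.
  by rewrite pair_bigA; apply: eq_bigr => q _; rewrite scalerA.
rewrite (scaleE (fun m i => g m 0 i)).
under [in X in _ <= X -> _]eq_bigr do rewrite -row_sum_delta.
rewrite card_prod !card_ord -/c => h; apply: le_trans (le_trans h _); last first.
  rewrite lerD2l le_eqVlt; apply/orP; left; apply/eqP; rewrite natrM.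
  by field; rewrite !pnatr_eq0 -!lt0n M0 s0.
rewrite le_eqVlt; apply/orP; left; apply/eqP; apply: eq_bigr => b _.
have avgE : \sum_(q : 'I_M * 'I_d)
    (M%:R^-1 * decode_coord s (g q.1) q.2 (b q)) *: delta_mx 0 q.2 = avg b.
  rewrite /avg; under [X in _ = _ *: X]eq_bigr do rewrite decode_sumE.
  rewrite -(scaleE (fun m i => decode_coord s (g m) i (b (m, i)))).
  by apply: eq_bigr => -[m i] _.
rewrite avgE; congr (_ * _); rewrite pair_bigA.
by apply: eq_bigr => -[m i] _.
Qed.

(** The M S samples enter with weight 1 / (M S)^2, which leaves 1 / (M S) of a
    single second moment. *)
Lemma sampled_average (D : 'I_M -> 'I_n -> 'rV[R]_d) (V : R) u :
  (forall m j, dotp (D m j) (D m j) <= V) ->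
  let avg (a : {ffun 'I_M * 'I_S -> 'I_n}) :=
    M%:R^-1 *: \sum_m S%:R^-1 *: \sum_r D m (a (m, r)) in
  let c := u + M%:R^-1 *: \sum_m n%:R^-1 *: \sum_j D m j in
  is_true (
    \sum_(a : {ffun 'I_M * 'I_S -> 'I_n}) (\prod_(m < M) \prod_(r < S) n%:R^-1)
       * dotp (u + avg a) (u + avg a)
    <= dotp c c + V / (M * S)%:R).
Proof.
move=> DV avg c.
have MR : M%:R != 0 :> R by rewrite pnatr_eq0 -lt0n.
have SR : S%:R != 0 :> R by rewrite pnatr_eq0 -lt0n.
have nR : n%:R != 0 :> R by rewrite pnatr_eq0 -lt0n.
pose iM : R := M%:R^-1; pose iS : R := S%:R^-1; pose iN : R := n%:R^-1.
pose X (q : 'I_M * 'I_S) j := (iM * iS) *: D q.1 j.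
pose mu (q : 'I_M * 'I_S) (j : 'I_n) : R := iN.
have mu1 q : \sum_j mu q j = 1.
  by rewrite /mu sumr_const card_ord -(mulr_natr iN) mulVf.
have := product_law_dotp_sum mu1 X u; rewrite /=.
have sumX (G : 'I_M -> 'I_S -> 'rV[R]_d) :
    \sum_(q : 'I_M * 'I_S) (iM * iS) *: G q.1 q.2
    = iM *: \sum_m iS *: \sum_r G m r.
  rewrite scaler_sumr; under [RHS]eq_bigr do rewrite scalerA scaler_sumr.
  by rewrite pair_bigA.
have meanX : \sum_q \sum_b mu q b *: X q b = iM *: \sum_m iN *: \sum_j D m j.
  transitivity (\sum_(q : 'I_M * 'I_S) (iM * iS) *: (iN *: \sum_j D q.1 j)).
    apply: eq_bigr => q _; rewrite scalerA [in RHS]mulrC -scalerA.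
    by rewrite !scaler_sumr.
  rewrite (sumX (fun m _ => iN *: \sum_j D m j)); congr (_ *: _).
  apply: eq_bigr => m _; rewrite sumr_const card_ord -[_ *+ S]scaler_nat scalerA.
  by rewrite mulVf// scale1r.
rewrite meanX.
rewrite -/c => hE; rewrite (_ : \sum_a _ = \sum_a product_law mu a
  * dotp (u + \sum_q X q (a q)) (u + \sum_q X q (a q))).
rewrite hE lerD2l; apply: (@le_trans _ _ (\sum_(q : 'I_M * 'I_S)
    (iM * iS) ^+ 2 * V)).
  apply: ler_sum => q _; apply: (@le_trans _ _ (\sum_j mu q j * dotp (X q j) (X q j))).
    by rewrite gerDl oppr_le0 dotp_ge0.
  rewrite -[leRHS]mul1r -(mu1 q) mulr_suml; apply: ler_sum => j _.
  rewrite ler_wpM2l ?invr_ge0// dotpZl dotpZr mulrA -expr2.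
  by rewrite ler_wpM2l ?sqr_ge0.
rewrite sumr_const card_prod !card_ord -mulr_natl natrM le_eqVlt.
by apply/orP; left; apply/eqP; rewrite /iM /iS; field; rewrite MR SR.
apply: eq_bigr => a _.
have avgE : \sum_q X q (a q) = avg a.
  rewrite /avg -(sumX (fun m r => D m (a (m, r)))).
  by apply: eq_bigr => -[m r] _.
by rewrite avgE pair_bigA.
Qed.

End Round.

Section RoundLaw.
Context {R : realType} {M n d S : nat}.
Variables (f : 'I_M -> 'I_n -> 'rV[R]_d -> R) (p : nat) (s1 s2 : nat -> nat).
Hypotheses (M0 : (0 < M)%N) (n0 : (0 < n)%N) (S0 : (0 < S)%N).
Variables (t : nat) (x : nat -> 'rV[R]_d).
Hypotheses (s1_gt0 : (0 < s1 t)%N) (s2_gt0 : (0 < s2 t)%N).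

Local Notation choices := (@choices M n d S).
(* The workers' vectors depend on the sampled indices only; the bits given here
   are arbitrary. *)
Local Notation workers a :=
  (worker_vec f p t x ((a, [ffun=> false], [ffun=> false]) : choices)).
Local Notation uniform := (\prod_(m < M) \prod_(r < S) (n%:R^-1 : R) : R).

Lemma big_choices (F : choices -> R) :
  \sum_w F w = \sum_a \sum_b \sum_c F (a, b, c).
Proof.
rewrite pair_bigA (pair_bigA _ (fun ab c => F (ab.1, ab.2, c))) /=.
by apply: eq_bigr => -[[a b] c].
Qed.

Lemma uniform_ge0 : 0 <= uniform.
Proof. by apply: prodr_ge0 => m _; apply: prodr_ge0 => r _; rewrite invr_ge0. Qed.

Lemma uniform_sum1 : \sum_(a : {ffun 'I_M * 'I_S -> 'I_n}) uniform = 1.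
Proof.
have mu1 (q : 'I_M * 'I_S) : \sum_(j < n) n%:R^-1 = 1 :> R.
  by rewrite sumr_const card_ord -(mulr_natr n%:R^-1) mulVf// pnatr_eq0 -lt0n.
rewrite -[RHS](product_law_sum1 mu1); apply: eq_bigr => a _.
by rewrite pair_bigA.
Qed.

Lemma bits_sum1 (I : finType) (g : I -> 'rV[R]_d) (k : I -> 'I_d) s :
  \sum_(b : {ffun I -> bool}) \prod_i bit_prob s (g i) (k i) (b i) = 1.
Proof. exact: (product_law_sum1 (fun i => bit_prob_sum1 s (g i) (k i))). Qed.

Lemma worker_bits_sum1 (g : 'I_M -> 'rV[R]_d) s :
  \sum_(b : {ffun 'I_M * 'I_d -> bool})
    \prod_(m < M) \prod_(i < d) bit_prob s (g m) i (b (m, i)) = 1.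
Proof.
rewrite -[RHS](bits_sum1 (fun q : 'I_M * 'I_d => g q.1) snd s).
by apply: eq_bigr => b _; rewrite pair_bigA; apply: eq_bigr => -[m i].
Qed.

Lemma choices_prob_ge0 w : 0 <= choices_prob f p s1 s2 t x (w : choices).
Proof.
apply: mulr_ge0; last by apply: prodr_ge0 => i _; apply: bit_prob_ge0.
apply: mulr_ge0; first exact: uniform_ge0.
by apply: prodr_ge0 => m _; apply: prodr_ge0 => i _; apply: bit_prob_ge0.
Qed.

Lemma choices_prob_sum1 : \sum_(w : choices) choices_prob f p s1 s2 t x w = 1.
Proof.
rewrite big_choices -[RHS]uniform_sum1; apply: eq_bigr => a _.
rewrite -[RHS]mulr1 -[X in _ = _ * X](worker_bits_sum1 (workers a) (s1 t)) mulr_sumr.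
apply: eq_bigr => b _.
transitivity (\sum_(c : {ffun 'I_d -> bool}) uniform
  * (\prod_(m < M) \prod_(i < d) bit_prob (s1 t) (workers a m) i (b (m, i)))
  * \prod_(i < d)
      bit_prob (s2 t) (master_vec f p s1 t x (a, b, [ffun=> false])) i (c i)).
  exact: eq_bigr.
rewrite -mulr_sumr.
rewrite (bits_sum1 (fun=> master_vec f p s1 t x (a, b, [ffun=> false])) id).
by rewrite mulr1.
Qed.

(** The two quantizations are unbiased, so they only add their variances to
    what remains of the randomness, that of the samples. *)
Lemma round_quantization (u : 'rV[R]_d) (B : R) :
  (forall w m, `|worker_vec f p t x (w : choices) m| <= B) ->
  \sum_(w : choices) choices_prob f p s1 s2 t x w
     * dotp (u + decode (s2 t) (master_vec f p s1 t x w) (master_bits w))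
            (u + decode (s2 t) (master_vec f p s1 t x w) (master_bits w))
  <= \sum_a uniform * dotp (u + M%:R^-1 *: \sum_m workers a m)
                           (u + M%:R^-1 *: \sum_m workers a m)
     + d%:R * (B ^+ 2 / (M%:R * (s1 t)%:R ^+ 2) + B ^+ 2 / (s2 t)%:R ^+ 2).
Proof.
move=> wB; rewrite big_choices; set q := d%:R * (_ + _).
have -> : q = \sum_(a : {ffun 'I_M * 'I_S -> 'I_n}) uniform * q.
  by rewrite -mulr_suml uniform_sum1 mul1r.
rewrite /q -big_split /=; apply: ler_sum => a _; rewrite -mulrDr.
pose Pb (b : {ffun 'I_M * 'I_d -> bool}) : R :=
  \prod_(m < M) \prod_(i < d) bit_prob (s1 t) (workers a m) i (b (m, i)).
pose avg (b : {ffun 'I_M * 'I_d -> bool}) : 'rV[R]_d :=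
  M%:R^-1 *: \sum_m decode (s1 t) (workers a m) (fun i => b (m, i)).
have Pb_ge0 b : 0 <= Pb b.
  by apply: prodr_ge0 => m _; apply: prodr_ge0 => i _; apply: bit_prob_ge0.
have MR : M%:R != 0 :> R by rewrite pnatr_eq0 -lt0n.
have avgB b : `|avg b| <= B.
  apply: average_norm_le => // m.
  exact: le_trans (norm_decode_le _ _ s1_gt0) (wB _ m).
apply: (@le_trans _ _ (uniform * \sum_b Pb b
    * (dotp (u + avg b) (u + avg b) + d%:R * (B ^+ 2 / (s2 t)%:R ^+ 2)))).
  rewrite mulr_sumr; apply: ler_sum => b _.
  rewrite (eq_bigr (fun c : {ffun 'I_d -> bool} => (uniform * Pb b) *
    ((\prod_(i < d) bit_prob (s2 t) (avg b) i (c i))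
     * dotp (u + decode (s2 t) (avg b) c) (u + decode (s2 t) (avg b) c)))); last first.
    by move=> c _; rewrite mulrA.
  rewrite -mulr_sumr mulrA ler_wpM2l ?mulr_ge0 ?uniform_ge0//.
  exact: quantized_vector.
rewrite ler_wpM2l ?uniform_ge0//.
have splitE (F : {ffun 'I_M * 'I_d -> bool} -> R) (e : R) :
    \sum_b Pb b * (F b + e) = \sum_b Pb b * F b + e.
  under eq_bigr do rewrite mulrDr.
  by rewrite big_split /= -mulr_suml worker_bits_sum1 mul1r.
rewrite splitE mulrDr addrA lerD2r.
exact: quantized_average.
Qed.

End RoundLaw.

(** * Gradient estimates of the finite-sum problem *)

Section Mean.
Context {R : realType} {d : nat}.
Implicit Types (x y : 'rV[R]_d).

(** Both sides of a descent inequality are linear in the function, so it passes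
    to averages with the same error term. *)
Lemma fmean_descent q (F : 'I_q -> 'rV[R]_d -> R) (c : R) x y : (0 < q)%N ->
  (forall r, differentiable (F r) x) ->
  (forall r, F r y <= F r x + dotp (y - x) (grad (F r) x) + c) ->
  fmean F y <= fmean F x + dotp (y - x) (grad (fmean F) x) + c.
Proof.
move=> q0 dF hF; have qR : 0 < q%:R :> R by rewrite ltr0n.
rewrite grad_fmean// dotpZr dotp_sumr /fmean -mulrDr -big_split /=.
rewrite -ler_pdivlMl ?invr_gt0// invrK mulrDr mulVKf ?gt_eqF//.
rewrite mulr_natl -[X in _ *+ X]card_ord -sumr_const -big_split /=.
exact: ler_sum.
Qed.

Lemma fmean_bounded q (F : 'I_q -> 'rV[R]_d -> R) (B : R) x : (0 < q)%N ->
  (forall r, `|F r x| <= B) -> `|fmean F x| <= B.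
Proof.
move=> q0 hF; rewrite normrM ger0_norm ?invr_ge0// ler_pdivrMl ?ltr0n//.
apply: le_trans (ler_norm_sum _ _ _) _; rewrite mulr_natl -[X in _ *+ X]card_ord.
by rewrite -sumr_const; exact: ler_sum.
Qed.

End Mean.

Section Problem.
Context {R : realType} {M n d S : nat}.
Variables (K : set 'rV[R]_d) (f : 'I_M -> 'I_n -> 'rV[R]_d -> R).
Variables (L G : R).
Hypotheses (M0 : (0 < M)%N) (n0 : (0 < n)%N) (S0 : (0 < S)%N).
Hypotheses (L0 : 0 < L) (Kconvex : convex_set K).
Hypothesis f_smooth : forall m j, smooth_on L K (f m j).
Hypothesis f_grad : forall m j x, K x -> `|grad (f m j) x| <= G.

Lemma f_differentiable m j x : K x -> differentiable (f m j) x.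
Proof. exact: (f_smooth m j).1. Qed.

Lemma objectiveE : objective f = fmean (fun m => fmean (f m)).
Proof.
apply/funext => x; rewrite /objective /fmean -mulr_sumr mulrA natrM.
by rewrite invfM.
Qed.

Lemma grad_local m x : K x ->
  grad (fmean (f m)) x = n%:R^-1 *: \sum_j grad (f m j) x.
Proof. by move=> Kx; rewrite grad_fmean// => j; exact: f_differentiable. Qed.

Lemma grad_objective x : K x ->
  grad (objective f) x = M%:R^-1 *: \sum_m grad (fmean (f m)) x.
Proof.
move=> Kx; rewrite objectiveE grad_fmean// => m.
by apply: differentiable_fmean => j; exact: f_differentiable.
Qed.

Lemma objective_descent x y : K x -> K y ->
  objective f y <= objective f x + dotp (y - x) (grad (objective f) x)
                   + L * dotp (y - x) (y - x).
Proof.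
move=> Kx Ky; rewrite objectiveE; apply: fmean_descent => // m.
  by apply: differentiable_fmean => j; exact: f_differentiable.
apply: fmean_descent => // j; first exact: f_differentiable.
exact: smooth_descent (f_smooth m j) Kx Ky.
Qed.

Lemma objective_bounded (B : R) x :
  (forall m j, `|f m j x| <= B) -> `|objective f x| <= B.
Proof.
by move=> fB; rewrite objectiveE; apply: fmean_bounded => // m; exact: fmean_bounded.
Qed.

Variables (p : nat) (s1 s2 : nat -> nat) (t : nat) (x : nat -> 'rV[R]_d).
Hypotheses (s1_gt0 : (0 < s1 t)%N) (s2_gt0 : (0 < s2 t)%N).
Local Notation choices := (@choices M n d S).
Local Notation decoded w :=
  (decode (s2 t) (master_vec f p s1 t x w) (master_bits w)).

(** At the start of a period every worker encodes a full local gradient: only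
    quantization errs. *)
Lemma round_start : (p %| t)%N -> K (x t) ->
  \sum_(w : choices) choices_prob f p s1 s2 t x w
     * dotp (decoded w - grad (objective f) (x t))
            (decoded w - grad (objective f) (x t))
  <= d%:R * (G ^+ 2 / (M%:R * (s1 t)%:R ^+ 2) + G ^+ 2 / (s2 t)%:R ^+ 2).
Proof.
move=> pt Kx.
have workE (w : choices) m : worker_vec f p t x w m = grad (fmean (f m)) (x t).
  by rewrite /worker_vec pt.
have wG (w : choices) m : `|worker_vec f p t x w m| <= G.
  rewrite workE grad_local//; apply: average_norm_le => // j; exact: f_grad.
have := @round_quantization _ _ _ _ S f p s1 s2 M0 n0 t x s1_gt0 s2_gt0
  (- grad (objective f) (x t)) G wG.
under eq_bigr do rewrite addrC; move/le_trans; apply; rewrite gerDr big1// => a _.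
have avgE :
    \sum_m worker_vec f p t x ((a, [ffun=> false], [ffun=> false]) : choices) m
    = \sum_m grad (fmean (f m)) (x t).
  by apply: eq_bigr => m _; exact: workE.
by rewrite avgE -grad_objective// addNr dotp0r mulr0.
Qed.

(** Inside a period the workers encode differences of gradients at two
    consecutive iterates. By smoothness these are small, and on average over
    samples and rounding the estimate follows the true gradient. *)
Lemma round_update (u : 'rV[R]_d) (V : R) : ~~ (p %| t)%N ->
  K (x t) -> K (x t.-1) -> L ^+ 2 * dotp (x t - x t.-1) (x t - x t.-1) <= V ->
  \sum_(w : choices) choices_prob f p s1 s2 t x w
     * dotp (u + decoded w) (u + decoded w)
  <= dotp (u + (grad (objective f) (x t) - grad (objective f) (x t.-1)))
          (u + (grad (objective f) (x t) - grad (objective f) (x t.-1)))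
     + (V / (M * S)%:R
        + d%:R * (V / (M%:R * (s1 t)%:R ^+ 2) + V / (s2 t)%:R ^+ 2)).
Proof.
move=> /negbTE pt Kx Kx' hV.
pose D m j := grad (f m j) (x t) - grad (f m j) (x t.-1).
have DV m j : dotp (D m j) (D m j) <= V.
  by apply: le_trans hV; exact: smooth_on_dotp (ltW L0) (f_smooth m j) Kx Kx'.
have V0 : 0 <= V by apply: le_trans hV; rewrite mulr_ge0 ?sqr_ge0 ?dotp_ge0.
have DB m j : `|D m j| <= Num.sqrt V.
  rewrite -[leLHS]normr_id -sqrtr_sqr ler_sqrt//.
  exact: le_trans (sqr_norm_le_dotp _) (DV m j).
have workE (w : choices) m :
    worker_vec f p t x w m = S%:R^-1 *: \sum_r D m (sample w m r).
  rewrite /worker_vec pt !grad_fmean; [|by move=> r; exact: f_differentiable..].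
  by rewrite -scalerBr -sumrB.
have wB (w : choices) m : `|worker_vec f p t x w m| <= Num.sqrt V.
  by rewrite workE; apply: average_norm_le.
have := @round_quantization _ _ _ _ S f p s1 s2 M0 n0 t x s1_gt0 s2_gt0 u _ wB.
rewrite sqr_sqrtr// => /le_trans; apply; rewrite addrA lerD2r.
have avgE a :
    \sum_m worker_vec f p t x ((a, [ffun=> false], [ffun=> false]) : choices) m
    = \sum_m S%:R^-1 *: \sum_r D m (a (m, r)).
  by apply: eq_bigr => m _; exact: workE.
under eq_bigr do rewrite avgE.
have -> : grad (objective f) (x t) - grad (objective f) (x t.-1)
    = M%:R^-1 *: \sum_m n%:R^-1 *: \sum_j D m j.
  rewrite !grad_objective// -scalerBr -sumrB; congr (_ *: _).
  by apply: eq_bigr => m _; rewrite !grad_local// -scalerBr -sumrB.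
exact: sampled_average.
Qed.

End Problem.

(** * Averaging over finite histories *)

Section Histories.
Context {R : realType} {disp : measure_display} {Omega : measurableType disp}.
Variable P : probability Omega R.

Lemma prob_partition (J : finType) (X : Omega -> J) (A : set Omega) :
  measurable A -> (forall j, measurable (X @^-1` [set j])) ->
  P A = (\sum_j P (A `&` X @^-1` [set j]))%E.
Proof.
move=> mA mX; pose F j := A `&` X @^-1` [set j].
have AE : A = \bigcup_(j in [set: J]) F j.
  by apply/seteqP; split=> [om Aom|om [j _ []]//]; exists (X om).
have Ftriv : trivIset [set: J] F.
  by move=> j k _ _ [om [[_ <-] [_ <-]]].
have Fmeas j : [set: J] j -> measurable (F j) by move=> _; apply: measurableI.
rewrite {1}AE measure_fin_bigcup//; last exact: finite_finset.
rewrite (@fsbigE _ _ _ _ _ (index_enum J)) ?index_enum_uniq//=.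
  by apply: eq_bigl => j; apply: mem_set.
by move=> j _; rewrite mem_index_enum.
Qed.

Lemma expectation_finite (J : finType) (X : Omega -> J) (val : J -> R)
    (Z : Omega -> R) :
  (forall j, measurable (X @^-1` [set j])) ->
  (forall om, Z om = val (X om)) -> (forall j, 0 <= val j) ->
  ('E_P[Z] = \sum_j (val j)%:E * P (X @^-1` [set j]))%E.
Proof.
move=> mX ZE val0; rewrite unlock.
transitivity (\int[P]_om (\sum_j ((val j)%:E * (\1_(X @^-1` [set j]) om)%:E)))%E.
  apply: eq_integral => om _; rewrite (bigD1 (X om))//= big1 ?adde0.
    by rewrite indicE mem_set// mule1 ZE.
  by move=> j /eqP jX; rewrite indicE memNset ?mule0//; apply: nesym.
rewrite ge0_integral_sum//.
- apply: eq_bigr => j _; rewrite ge0_integralZl_EFin ?val0//.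
    by rewrite integral_indic// setIT.
  by apply/measurable_EFinP.
- by move=> j; apply: emeasurable_funM => //; apply/measurable_EFinP.
- by move=> j om _; rewrite mule_ge0// lee_fin.
Qed.

End Histories.

Section HistoryMean.
Context {R : realType} {disp : measure_display} {Omega : measurableType disp}.
Variables (P : probability Omega R) (C : finType) (W : nat -> Omega -> C).
Variable T : nat.
Hypothesis mW : forall t w, (t < T)%N -> measurable [set om | W t om = w].

(** Nested pairs, so that a sum over the histories of t + 1 rounds is by
    construction a double sum over a history of t rounds and a choice. *)
Fixpoint history (t : nat) : finType :=
  if t is t'.+1 then (history t' * C)%type else unit.

Fixpoint hist (t : nat) (om : Omega) : history t :=
  if t is t'.+1 return history t then (hist t' om, W t' om) else tt.

Lemma hist_eqP t om om' :
  hist t om = hist t om' <-> forall u, (u < t)%N -> W u om = W u om'.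
Proof.
elim: t => [|t IH] /=; first by split.
split=> [[h Wt] u|WW]; first by rewrite ltnS leq_eqVlt => /predU1P[->//|]; exact: IH.1.
by congr (_, _); [apply: IH.2 => u ut; apply: WW; exact: ltnW|exact: WW].
Qed.

Lemma hist_preimageS t (h : history t) w :
  hist t.+1 @^-1` [set (h, w)] = hist t @^-1` [set h] `&` [set om | W t om = w].
Proof. by apply/seteqP; split=> om /= [] => [<- <-|-> ->]. Qed.

Lemma measurable_hist t (h : history t) : (t <= T)%N ->
  measurable (hist t @^-1` [set h]).
Proof.
elim: t h => [|t IH] h tT.
  rewrite (_ : _ @^-1` _ = setT); first exact: measurableT.
  by apply/seteqP; split=> // om _; case: h.
case: h => h w; rewrite hist_preimageS.
by apply: measurableI; [apply: IH; exact: ltnW|exact: mW].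
Qed.

Definition prob_hist t (h : history t) : R := fine (P (hist t @^-1` [set h])).

Lemma prob_histE t (h : history t) : (t <= T)%N ->
  (prob_hist h)%:E = P (hist t @^-1` [set h]).
Proof.
by move=> tT; rewrite fineK// fin_num_measure//; exact: measurable_hist.
Qed.

Lemma prob_hist_ge0 t (h : history t) : 0 <= prob_hist h.
Proof. by rewrite fine_ge0. Qed.

Lemma prob_hist_step t (h : history t) : (t < T)%N ->
  prob_hist h = \sum_w prob_hist ((h, w) : history t.+1).
Proof.
move=> tT; apply: EFin_inj; rewrite (prob_histE _ (ltnW tT)) -sumEFin.
rewrite (prob_partition P (X := W t))//; [|exact: measurable_hist (ltnW tT)|].
  by apply: eq_bigr => w _; rewrite (prob_histE _ tT) hist_preimageS.
by move=> w; exact: mW.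
Qed.

Lemma prob_hist_sum1 t : (t <= T)%N -> \sum_(h : history t) prob_hist h = 1.
Proof.
elim: t => [|t IH] tT.
  rewrite (big_pred1 tt) => [|[]//]; apply: EFin_inj; rewrite prob_histE//.
  rewrite (_ : _ @^-1` _ = setT) ?probability_setT//.
  by apply/seteqP; split=> // om _; case: (hist 0 om).
rewrite -[RHS](IH (ltnW tT)).
under [RHS]eq_bigr do rewrite prob_hist_step//.
by rewrite pair_bigA; apply: eq_bigr => -[].
Qed.

(** The value of Z on a history, read off at an arbitrary point of the event
    that this history occurs; impossible histories have probability zero. *)
Definition on_history t (Z : Omega -> R) (h : history t) : R :=
  if pselect (exists om, hist t om = h) is left ex then Z (projT1 (cid ex))
  else 0.

Definition determined {V : Type} t (Z : Omega -> V) : Prop :=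
  forall om om', hist t om = hist t om' -> Z om = Z om'.

Lemma determinedW V t t' (Z : Omega -> V) : (t <= t')%N ->
  determined t Z -> determined t' Z.
Proof.
move=> tt' dZ om om' /hist_eqP h; apply: dZ; apply/hist_eqP => u ut.
by apply: h; apply: leq_trans tt'.
Qed.

Lemma on_hist t Z om : determined t Z -> on_history Z (hist t om) = Z om.
Proof.
rewrite /on_history => dZ; case: pselect => [ex|[]]; last by exists om.
by apply: dZ; exact: (projT2 (cid ex)).
Qed.

Lemma on_history_ge0 t Z (h : history t) :
  (forall om, 0 <= Z om) -> 0 <= on_history Z h.
Proof. by move=> Z0; rewrite /on_history; case: pselect. Qed.

Lemma prob_hist_impossible t (h : history t) :
  ~ (exists om, hist t om = h) -> prob_hist h = 0.
Proof.
move=> nh; rewrite /prob_hist (_ : _ @^-1` _ = set0) ?measure0//.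
by apply/seteqP; split=> // om /= hom; apply: nh; exists om.
Qed.

Definition history_mean t (Z : Omega -> R) : R :=
  \sum_(h : history t) prob_hist h * on_history Z h.

Lemma le_history_mean t Z Z' : (forall om, Z om <= Z' om) ->
  history_mean t Z <= history_mean t Z'.
Proof.
move=> ZZ'; apply: ler_sum => h _; rewrite ler_wpM2l ?prob_hist_ge0//.
by rewrite /on_history; case: pselect.
Qed.

Lemma history_meanD t Z Z' :
  history_mean t (fun om => Z om + Z' om) = history_mean t Z + history_mean t Z'.
Proof.
rewrite -big_split /=; apply: eq_bigr => h _; rewrite -mulrDr; congr (_ * _).
by rewrite /on_history; case: pselect => // _; rewrite addr0.
Qed.

Lemma history_meanZ t a Z :
  history_mean t (fun om => a * Z om) = a * history_mean t Z.
Proof.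
rewrite mulr_sumr; apply: eq_bigr => h _; rewrite mulrCA; congr (_ * _).
by rewrite /on_history; case: pselect => // _; rewrite mulr0.
Qed.

Lemma history_mean_cst t a : (t <= T)%N -> history_mean t (fun=> a) = a.
Proof.
move=> tT; rewrite -[RHS]mul1r -(prob_hist_sum1 tT) mulr_suml.
apply: eq_bigr => h _; rewrite /on_history; case: pselect => // nh.
by rewrite prob_hist_impossible// !mul0r.
Qed.

Lemma history_mean_sum t (I : Type) (r : seq I) (Z : I -> Omega -> R) :
  (t <= T)%N ->
  history_mean t (fun om => \sum_(i <- r) Z i om)
  = \sum_(i <- r) history_mean t (Z i).
Proof.
move=> tT; elim: r => [|i r IH].
  by under eq_fun do rewrite big_nil; rewrite big_nil history_mean_cst.
by under eq_fun do rewrite big_cons; rewrite big_cons history_meanD IH.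
Qed.

(** The transition probabilities c of the choices given the past. *)
Variable c : nat -> Omega -> C -> R.
Hypothesis c_ge0 : forall t om w, (t < T)%N -> 0 <= c t om w.
Hypothesis c_sum1 : forall t om, (t < T)%N -> \sum_w c t om w = 1.
Hypothesis c_determined : forall t w, (t < T)%N -> determined t (fun om => c t om w).
Hypothesis c_law : forall t om, (t < T)%N ->
  P (hist t.+1 @^-1` [set hist t.+1 om])
  = (P (hist t @^-1` [set hist t om]) * (c t om (W t om))%:E)%E.

(** The transition law is only assumed along outcomes that occur. For a choice
    that never occurs after a given past both sides vanish, because the choices
    that do occur already exhaust the probability of the past. *)
Lemma prob_hist_transition t om w : (t < T)%N ->
  prob_hist ((hist t om, w) : history t.+1) = prob_hist (hist t om) * c t om w.
Proof.
move=> tT; pose a w := prob_hist ((hist t om, w) : history t.+1).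
pose b w := prob_hist (hist t om) * c t om w; rewrite -/(a w) -/(b w).
have ab v : a v <= b v.
  have [[om' hv]|nh] := pselect (exists om', hist t.+1 om' = (hist t om, v)).
    rewrite le_eqVlt; apply/orP; left; apply/eqP; apply: EFin_inj.
    move: hv => /= [h1 h2]; have := c_law om' tT.
    rewrite /a /b EFinM (prob_histE _ tT) (prob_histE _ (ltnW tT)) /= h1 h2 => ->.
    by rewrite (c_determined _ tT h1).
  by rewrite /a prob_hist_impossible// mulr_ge0 ?prob_hist_ge0 ?c_ge0.
have : \sum_v (b v - a v) = 0.
  by rewrite sumrB -mulr_sumr c_sum1// mulr1 /a -prob_hist_step// subrr.
move/eqP; rewrite psumr_eq0 => [|v _]; last by rewrite subr_ge0.
by move=> /allP/(_ w (mem_index_enum w))/=; rewrite subr_eq0 => /eqP->.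
Qed.

(** The tower property: the weights factor by prob_hist_transition, and given
    the past only the choice of the last round still varies in F. *)
Lemma history_mean_tower t (F : Omega -> C -> R) : (t < T)%N ->
  (forall w, determined t (F ^~ w)) ->
  history_mean t.+1 (fun om => F om (W t om))
  = history_mean t (fun om => \sum_w c t om w * F om w).
Proof.
move=> tT dF; rewrite /history_mean.
transitivity (\sum_(h : history t) \sum_w prob_hist ((h, w) : history t.+1)
    * @on_history t.+1 (fun om => F om (W t om)) (h, w)).
  by rewrite pair_bigA; apply: eq_bigr => -[].
apply: eq_bigr => h _.
have [[om <-]|nh] := pselect (exists om, hist t om = h); last first.
  rewrite prob_hist_impossible// mul0r big1// => w _.
  rewrite prob_hist_impossible ?mul0r// => -[om /= [hom _]].
  by apply: nh; exists om.
have dZ : determined t (fun om => \sum_w c t om w * F om w).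
  move=> om1 om2 h12; apply: eq_bigr => w _.
  by rewrite (c_determined _ tT h12) (dF w _ _ h12).
rewrite (on_hist _ dZ) mulr_sumr; apply: eq_bigr => w _.
rewrite mulrA -prob_hist_transition//.
have [[om' hw]|nw] := pselect (exists om', hist t.+1 om' = (hist t om, w)).
  congr (_ * _); rewrite -hw on_hist; first by case: hw => /dF -> ->.
  by move=> om1 om2 /= [h12 ->]; exact: dF.
by rewrite prob_hist_impossible// !mul0r.
Qed.

Lemma history_mean_step t Z : (t < T)%N -> determined t Z ->
  history_mean t.+1 Z = history_mean t Z.
Proof.
move=> tT dZ; rewrite (history_mean_tower tT (F := fun om _ => Z om))//.
by congr history_mean; apply/funext => om; rewrite -mulr_suml c_sum1// mul1r.
Qed.

Lemma history_mean_past t Z : (t <= T)%N -> determined t Z ->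
  history_mean T Z = history_mean t Z.
Proof.
move=> tT dZ; rewrite -(subnKC tT); have := leqnn (T - t)%N.
elim: {-2}(T - t)%N => [|k IH] kT; first by rewrite addn0.
rewrite addnS history_mean_step ?IH ?(ltnW kT)//; first by rewrite -ltn_subRL.
by apply: determinedW dZ; exact: leq_addr.
Qed.

(** The output index is independent of the history, so that the joint law of
    both has product form; on each joint outcome the integrand is constant. *)
Lemma expectation_uniform_out (out : Omega -> 'I_T) (G : 'I_T -> Omega -> R) :
  (forall o, measurable [set om | out om = o]) ->
  (forall om o, P (hist T @^-1` [set hist T om] `&` [set om' | out om' = o])
     = (P (hist T @^-1` [set hist T om]) * (T%:R^-1)%:E)%E) ->
  (forall o, determined T (G o)) -> (forall o om, 0 <= G o om) ->
  ('E_P[fun om => G (out om) om]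
   = (T%:R^-1 * history_mean T (fun om => \sum_o G o om))%:E)%E.
Proof.
move=> mout outlaw dG G0.
pose X om := (hist T om, out om).
have XE h o : X @^-1` [set (h, o)]
    = hist T @^-1` [set h] `&` [set om | out om = o].
  by apply/seteqP; split=> om; rewrite /X /= => -[-> ->].
rewrite (expectation_finite P (X := X) (val := fun q => on_history (G q.2) q.1)).
- rewrite /history_mean mulr_sumr -sumEFin.
  transitivity (\sum_h \sum_o ((on_history (G o) h)%:E * P (X @^-1` [set (h, o)])))%E.
    by rewrite pair_bigA; apply: eq_bigr => -[].
  apply: eq_bigr => h _.
  have [[om <-]|nh] := pselect (exists om, hist T om = h); last first.
    rewrite prob_hist_impossible// mul0r mulr0 big1// => o _.
    rewrite (_ : X @^-1` _ = set0) ?measure0 ?mule0//.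
    by rewrite XE; apply/seteqP; split=> // om [/= hom _]; apply: nh; exists om.
  rewrite on_hist => [|om1 om2 h12]; last by apply: eq_bigr => o _; exact: dG.
  rewrite !mulr_sumr -sumEFin; apply: eq_bigr => o _.
  rewrite on_hist//; rewrite XE outlaw -prob_histE// -!EFinM; congr EFin; ring.
- by case=> h o; rewrite XE; apply: measurableI => //; exact: measurable_hist.
- by move=> om /=; rewrite on_hist.
- by case=> h o; exact: on_history_ge0.
Qed.

End HistoryMean.

(** * Convergence of a run *)

Section FrankWolfeStep.
Context {R : realType} {M n d : nat}.
Variables (K : set 'rV[R]_d) (f : 'I_M -> 'I_n -> 'rV[R]_d -> R) (L D2 : R).
Hypotheses (M0 : (0 < M)%N) (n0 : (0 < n)%N) (L0 : 0 < L).
Hypothesis Kconvex : convex_set K.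
Hypothesis f_smooth : forall m j, smooth_on L K (f m j).
Hypothesis K_diam : forall x y, K x -> K y -> dotp (x - y) (x - y) <= D2.
Local Notation F := (objective f).

Lemma fw_gap_ge0 x : K x -> 0 <= fw_gap K F x.
Proof.
move=> Kx; apply: ub_le_sup; last first.
  by exists x => //; rewrite subrr dotpC dotp0r.
exists (D2 + dotp (grad F x) (grad F x)) => _ [v Kv <-].
have := dotp_young (v - x) (- grad F x) (@ltr01 R).
rewrite invr1 !mul1r dotpNl [in X in _ <= X]dotpNr opprK => young.
have := K_diam Kv Kx; have := dotp_ge0 (v - x); have := dotp_ge0 (grad F x).
by move: young; lra.
Qed.

(** One step decreases the objective by the gap, up to the error of the
    gradient estimate, which Young's inequality weighs by theta. *)
Lemma fw_step x v gb eta theta : 0 < eta -> 0 < theta ->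
  K x -> K (x + eta *: (v - x)) -> linear_argmin K gb v ->
  fw_gap K F x
  <= (F x - F (x + eta *: (v - x))) / eta + L * eta * D2
     + (theta * dotp (gb - grad F x) (gb - grad F x) + theta^-1 * D2) / 2.
Proof.
move=> eta0 theta0 Kx Kx' [Kv vmin].
apply: ge_sup => [|_ [w Kw <-]]; first by exists (dotp (x - x) (- grad F x)); exists x.
set g := grad F x; set e := gb - g.
have descent := objective_descent M0 n0 L0 Kconvex f_smooth Kx Kx'.
rewrite -/g [_ + _ - x]addrC addKr !dotpZl dotpZr in descent.
have {}descent : - dotp (v - x) g
    <= (F x - F (x + eta *: (v - x))) / eta + L * eta * D2.
  rewrite -subr_ge0 -(pmulr_rge0 _ eta0) mulrBr mulrDr [eta * (_ / _)]mulrC.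
  rewrite divfK ?gt_eqF// subr_ge0.
  have : L * (eta * (eta * dotp (v - x) (v - x))) <= L * (eta * (eta * D2)).
    by rewrite !ler_pM2l// K_diam.
  move: descent; nra.
have := vmin w Kw; have := dotp_young e (w - v) theta0.
have : theta^-1 * dotp (w - v) (w - v) <= theta^-1 * D2.
  by rewrite ler_pM2l ?invr_gt0// K_diam.
move: descent; rewrite (dotpC e) /e !(dotpDl, dotpDr, dotpNl, dotpNr).
by lra.
Qed.

End FrankWolfeStep.

Section RunAnalysis.
Context {R : realType} {M n d T p S : nat}.
Variables (K : set 'rV[R]_d) (f : 'I_M -> 'I_n -> 'rV[R]_d -> R).
Variables (L G D2 B a b : R) (s1 s2 : nat -> nat).
Context {disp : measure_display} {Omega : measurableType disp}.
Variables (P : probability Omega R) (x1 : 'rV[R]_d).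
Variables (W : nat -> Omega -> @choices M n d S).
Variables (x gbar v : nat -> Omega -> 'rV[R]_d) (out : Omega -> 'I_T).
Hypotheses (M0 : (0 < M)%N) (n0 : (0 < n)%N) (S0 : (0 < S)%N) (T0 : (0 < T)%N).
Hypotheses (L0 : 0 < L) (Kconvex : convex_set K).
Hypothesis f_smooth : forall m j, smooth_on L K (f m j).
Hypothesis f_bounded : forall m j y, K y -> `|f m j y| <= B.
Hypothesis f_grad : forall m j y, K y -> `|grad (f m j) y| <= G.
Hypothesis K_diam : forall y z, K y -> K z -> dotp (y - z) (y - z) <= D2.
Hypotheses (s1_gt0 : forall t, (0 < s1 t)%N) (s2_gt0 : forall t, (0 < s2 t)%N).

Local Notation q := (Num.sqrt T%:R : R).
Local Notation F := (objective f).
Local Notation V := (L ^+ 2 * (q^-1 ^+ 2 * D2)).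

Hypothesis a_ge : forall t, (p %| t)%N ->
  d%:R * (G ^+ 2 / (M%:R * (s1 t)%:R ^+ 2) + G ^+ 2 / (s2 t)%:R ^+ 2) <= a.
Hypothesis b_ge : forall t, ~~ (p %| t)%N ->
  V / (M * S)%:R + d%:R * (V / (M%:R * (s1 t)%:R ^+ 2) + V / (s2 t)%:R ^+ 2) <= b.
Hypothesis b_ge0 : 0 <= b.
Hypothesis p_gt0 : (0 < p)%N.
Hypothesis Kx1 : K x1.
Hypothesis run : qfw_run K f p (fun=> q^-1) s1 s2 P x1 W x gbar v out.

Let q_gt0 : 0 < q.
Proof. by rewrite sqrtr_gt0 ltr0n. Qed.

Let q_sqr : q * q = T%:R.
Proof. by rewrite -expr2 sqr_sqrtr. Qed.

Lemma run_in_K t om : (t <= T)%N -> K (x t om).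
Proof.
elim: t => [|t IH] tT; first by rewrite (qfw_start run).
rewrite (qfw_step run)//; apply: convex_segment => //; first exact: IH (ltnW tT).
  exact: (qfw_argmin run om tT).1.
rewrite invr_ge0 sqrtr_ge0/= invf_le1// -[X in X <= _]sqrtr1 ler_sqrt ?ler0n//.
by rewrite ler1n.
Qed.

Local Notation determined := (determined W).

Lemma x_determined t : (t <= T)%N -> determined t (x t).
Proof.
elim: t => [_ om om' _|t IH tT om om' h]; first by rewrite !(qfw_start run).
have xt : x t om = x t om' by apply: IH (ltnW tT) _ _ _; case: h.
rewrite !(qfw_step run)// xt; congr (_ + _ *: (_ - _)).
apply: (qfw_nonanticipating run) => // u ut.
exact: ((hist_eqP W t.+1 om om').1 h).
Qed.

(** A round reads the trajectory at its current and previous point only; this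
    is what makes its transition probabilities functions of the past. *)
Lemma worker_vec_ext t (y z : nat -> 'rV[R]_d) :
  y t = z t -> y t.-1 = z t.-1 ->
  @worker_vec R M n d f p S t y = worker_vec f p t z.
Proof.
move=> e1 e2; apply/funext => w; apply/funext => m.
by rewrite /worker_vec e1 e2.
Qed.

Lemma worker_vec_determined t : (t <= T)%N ->
  determined t (fun om => @worker_vec R M n d f p S t (x ^~ om)).
Proof.
move=> tT om om' h; apply: worker_vec_ext; first exact: x_determined h.
by apply: (determinedW (leq_pred t) (x_determined _)) h; rewrite (leq_trans (leq_pred t)).
Qed.

Lemma master_vec_determined t : (t <= T)%N ->
  determined t (fun om => @master_vec R M n d f p S s1 t (x ^~ om)).
Proof.
move=> tT om om' h; apply/funext => w.
by rewrite /master_vec (worker_vec_determined tT h).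
Qed.

Lemma choices_prob_determined t w : (t < T)%N ->
  determined t (fun om => @choices_prob R M n d f p S s1 s2 t (x ^~ om) w).
Proof.
move=> tT om om' h; rewrite /choices_prob (worker_vec_determined (ltnW tT) h).
by rewrite (master_vec_determined (ltnW tT) h).
Qed.

Lemma gbar_determined t : (t < T)%N -> determined t.+1 (gbar t).
Proof.
elim: t => [|t IH] tT om om' h; have h1 := congr1 fst h; have h2 := congr1 snd h;
  rewrite /= in h1 h2; rewrite (qfw_gbar run om tT) (qfw_gbar run om' tT).
  by rewrite dvdn0 (@master_vec_determined 0 (leq0n T) om om' h1) h2.
rewrite (master_vec_determined (ltnW tT) h1) h2; case: ifP => // _.
by congr (_ + _); apply: IH h1; exact: ltnW.
Qed.

Let c t om w := @choices_prob R M n d f p S s1 s2 t (x ^~ om) w.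

Let c_ge0 t om w : (t < T)%N -> 0 <= c t om w.
Proof. by move=> _; exact: choices_prob_ge0. Qed.

Let c_sum1 t om : (t < T)%N -> \sum_w c t om w = 1.
Proof. by move=> _; exact: choices_prob_sum1. Qed.

Let mW := qfw_measurable_choices run.

Lemma pastE t om : past W t om = hist W t @^-1` [set hist W t om].
Proof.
apply/seteqP; split=> om' /=; first by move=> h; exact/hist_eqP.
by move/hist_eqP.
Qed.

Let c_law t om : (t < T)%N ->
  P (hist W t.+1 @^-1` [set hist W t.+1 om])
  = (P (hist W t @^-1` [set hist W t om]) * (c t om (W t om))%:E)%E.
Proof. by move=> tT; rewrite -!pastE; exact: (qfw_choices_law run). Qed.

Local Notation mean := (history_mean P W).
Let tower t Z := @history_mean_tower _ _ _ P _ W T mW c c_ge0 c_sum1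
  choices_prob_determined c_law t Z.

Definition estimate_error t om : 'rV[R]_d := gbar t om - grad F (x t om).
Local Notation e := estimate_error.
Local Notation decoded t om w :=
  (decode (s2 t) (master_vec f p s1 t (x ^~ om) w) (master_bits w)).

Lemma error_determined t : (t < T)%N -> determined t.+1 (e t).
Proof.
move=> tT om om' h; rewrite /e (gbar_determined tT h).
by rewrite (determinedW (leqnSn t) (x_determined (ltnW tT)) h).
Qed.

Lemma error_start t : (t < T)%N -> (p %| t)%N ->
  mean t.+1 (fun om => dotp (e t om) (e t om)) <= a.
Proof.
move=> tT pt; pose Fw om (w : @choices M n d S) :=
  dotp (decoded t om w - grad F (x t om)) (decoded t om w - grad F (x t om)).
have -> : (fun om => dotp (e t om) (e t om)) = (fun om => Fw om (W t om)).
  by apply/funext => om; rewrite /e (qfw_gbar run)// pt addr0.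
rewrite (@tower t Fw tT); last first.
  move=> w om om' h; rewrite /Fw (master_vec_determined (ltnW tT) h).
  by rewrite (x_determined (ltnW tT) h).
rewrite -[leRHS](history_mean_cst P mW _ (ltnW tT)); apply: le_history_mean => om.
apply: le_trans (a_ge pt); apply: round_start => //.
exact: run_in_K (ltnW tT).
Qed.

(** The noise of a round is centred given the past, so it is orthogonal to the
    error carried over from the previous round. *)
Lemma error_update t : (t.+1 < T)%N -> ~~ (p %| t.+1)%N ->
  mean t.+2 (fun om => dotp (e t.+1 om) (e t.+1 om))
  <= mean t.+1 (fun om => dotp (e t om) (e t om)) + b.
Proof.
move=> tT pt; pose u om := gbar t om - grad F (x t.+1 om).
pose Fw om (w : @choices M n d S) :=
  dotp (u om + decoded t.+1 om w) (u om + decoded t.+1 om w).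
have -> : (fun om => dotp (e t.+1 om) (e t.+1 om)) = (fun om => Fw om (W t.+1 om)).
  apply/funext => om; rewrite /e (qfw_gbar run om tT) (negbTE pt) /Fw /u /=.
  by rewrite -addrA addrC.
rewrite (@tower t.+1 Fw tT); last first.
  move=> w om om' h; rewrite /Fw /u (master_vec_determined (ltnW tT) h).
  by rewrite (x_determined (ltnW tT) h) (gbar_determined (ltnW tT) h).
rewrite -[X in _ <= _ + X](history_mean_cst P mW _ (ltnW tT)) -history_meanD.
apply: le_history_mean => om.
have Kx := run_in_K om (ltnW tT); have Kx' := run_in_K om (ltnW (ltnW tT)).
have hV : L ^+ 2 * dotp (x t.+1 om - x t om) (x t.+1 om - x t om) <= V.
  rewrite ler_wpM2l ?sqr_ge0// (qfw_step run) ?(ltnW tT)//.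
  rewrite [_ + _ - _]addrC addKr dotpZl dotpZr mulrA -expr2.
  rewrite ler_wpM2l ?sqr_ge0// K_diam//.
  exact: (qfw_argmin run om (ltnW tT)).1.
have := @round_update _ _ _ _ S K f L M0 n0 S0 L0 f_smooth p s1 s2 t.+1 (x ^~ om)
  (s1_gt0 _) (s2_gt0 _) (u om) V pt Kx Kx' hV.
rewrite /= => /le_trans; apply.
have -> : u om + (grad F (x t.+1 om) - grad F (x t om)) = e t om.
  by rewrite /u addrA subrK.
by rewrite lerD2l; exact: b_ge.
Qed.

(** Each period starts afresh with error at most a, and at most p rounds later
    the next one starts. *)
Lemma error_bound t : (t < T)%N ->
  mean t.+1 (fun om => dotp (e t om) (e t om)) <= a + p%:R * b.
Proof.
move=> tT; apply: (@le_trans _ _ (a + (t %% p)%:R * b)); last first.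
  by rewrite lerD2l ler_wpM2r// ler_nat ltnW// ltn_pmod.
elim: t tT => [|t IH] tT; first by rewrite mod0n mul0r addr0 error_start.
rewrite modnS; case: ifPn => pt; first by rewrite mul0r addr0 error_start.
apply: le_trans (error_update tT pt) _.
by rewrite -natr1 mulrDl mul1r addrA lerD2r; apply: IH; exact: ltnW.
Qed.

(** The decreases of the objective telescope. The weight theta = T^(1/2) in
    Young's inequality balances squared errors of order 1 / T against the
    squared diameter. *)
Lemma gap_sum_bound om :
  \sum_(t < T) fw_gap K F (x t om)
  <= q * (2 * B + (L + 2^-1) * D2) + \sum_(t < T) 2^-1 * q * dotp (e t om) (e t om).
Proof.
have step (t : 'I_T) : fw_gap K F (x t om)
    <= q * (F (x t om) - F (x t.+1 om))
       + ((L + 2^-1) * q^-1 * D2 + 2^-1 * q * dotp (e t om) (e t om)).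
  have := @fw_step _ _ _ _ K f L D2 M0 n0 L0 Kconvex f_smooth K_diam
    (x t om) (v t om) (gbar t om) q^-1 q.
  rewrite -(qfw_step run om (ltn_ord t)) invr_gt0 invrK => /(_ q_gt0 q_gt0).
  move=> /(_ (run_in_K om (ltnW (ltn_ord t))) (run_in_K om (ltn_ord t))
             (qfw_argmin run om (ltn_ord t))) /le_trans; apply.
  by rewrite -/(e t om) le_eqVlt; apply/orP; left; apply/eqP; field; rewrite gt_eqF.
apply: le_trans (ler_sum _ (fun t _ => step t)) _.
rewrite !big_split /= addrA lerD2r -mulr_sumr.
rewrite -(big_mkord xpredT (fun t => F (x t om) - F (x t.+1 om))).
rewrite (eq_bigr (fun t => - (F (x t.+1 om) - F (x t om)))); last first.
  by move=> t _; rewrite opprB.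
rewrite sumrN telescope_sumr// opprB sumr_const card_ord.
have bound t : (t <= T)%N -> `|F (x t om)| <= B.
  by move=> tT; apply: objective_bounded => // m j; apply/f_bounded/run_in_K.
have := bound 0%N (leq0n _); have := bound T (leqnn _); rewrite !ler_norml.
move=> /andP[b1 b2] /andP[b3 b4].
have -> : ((L + 2^-1) * q^-1 * D2) *+ T = q * ((L + 2^-1) * D2).
  by rewrite -mulr_natl -[X in X * _ = _]q_sqr; field; rewrite gt_eqF.
by rewrite -mulrDr ler_pM2l//; lra.
Qed.

Theorem expected_gap_bound :
  ('E_P[fun om => fw_gap K F (x (out om) om)]
   <= ((2 * B + (L + 2^-1) * D2 + 2^-1 * (T%:R * (a + p%:R * b))) / q)%:E)%E.
Proof.
rewrite (@expectation_uniform_out _ _ _ P _ W T mW out (fun o om => fw_gap K F (x o om))).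
- rewrite lee_fin.
  have := @le_history_mean _ _ _ P _ W T _ _ gap_sum_bound.
  rewrite history_meanD (history_mean_cst P mW)//.
  rewrite (@history_mean_sum _ _ _ P _ W T mW T _ _
    (fun (t : 'I_T) om => 2^-1 * q * dotp (e t om) (e t om)) (leqnn T)) => hE.
  have : \sum_(t < T) mean T (fun om => 2^-1 * q * dotp (e t om) (e t om))
      <= \sum_(t < T) 2^-1 * q * (a + p%:R * b).
    apply: ler_sum => t _; rewrite history_meanZ ler_pM2l ?mulr_gt0//.
    rewrite (history_mean_past mW c_ge0 c_sum1 choices_prob_determined c_law (ltn_ord t)).
      exact: error_bound.
    by move=> om om' h; rewrite (error_determined (ltn_ord t) h).
  rewrite sumr_const card_ord -[X in _ <= X -> _]mulr_natl => hS.
  rewrite mulrC ler_pdivrMr ?ltr0n//; set N := (X in _ <= X / _ * _).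
  have -> : N / q * T%:R = q * N.
    by rewrite -[X in _ * X = _]q_sqr; field; rewrite gt_eqF.
  apply: le_trans hE _; apply: le_trans (lerD (lexx _) hS) _.
  by rewrite le_eqVlt; apply/orP; left; apply/eqP; rewrite /N; ring.
- exact: qfw_measurable_out run.
- by move=> om o; rewrite -pastE; exact: (qfw_out_law run).
- move=> o om om' h; congr fw_gap.
  exact: (determinedW (ltnW (ltn_ord o)) (x_determined (ltnW (ltn_ord o)))) h.
- by move=> o om; apply: (fw_gap_ge0 f K_diam); exact: run_in_K (ltnW (ltn_ord o)).
Qed.

End RunAnalysis.

(** * Choice of the parameters *)

Section RoundUp.
Context {R : realType}.
Implicit Types (a : R).

Lemma round_up_gt0 a : (0 < round_up a)%N.
Proof. by rewrite /round_up leq_maxl. Qed.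

Lemma round_up_ge a : a <= (round_up a)%:R.
Proof.
have [a0|a0] := leP a 0; first exact: le_trans a0 (ler0n _ _).
have c0 : (0 <= Num.ceil a)%R by rewrite -(ler0z R) (le_trans (ltW a0))// ceil_ge.
apply: le_trans (ceil_ge a) _; rewrite -{1}(gez0_abs c0) ler_nat.
exact: leq_maxr.
Qed.

Lemma round_up_le a : 0 <= a -> (round_up a)%:R <= a + 1.
Proof.
move=> a0; have c0 : (0 <= Num.ceil a)%R by rewrite -(ler0z R) (le_trans a0)// ceil_ge.
rewrite /round_up /maxn; case: ifP => _; last by rewrite lerDr.
rewrite natr_absz ger0_norm//; have /andP[h _] := ceil_itv a.
by move: h; rewrite intrB => /ltW; lra.
Qed.

End RoundUp.

Lemma count_multiples p T : (0 < p)%N ->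
  (\sum_(t < T) (p %| t : nat) <= (T %/ p).+1)%N.
Proof.
move=> p0; case: T => [|T]; first by rewrite big_ord0.
suff -> : (\sum_(t < T.+1) (p %| t : nat) = (T %/ p).+1)%N.
  by rewrite ltnS leq_div2r.
elim: T => [|T IH]; first by rewrite big_ord1 dvdn0 div0n.
by rewrite big_ord_recr /= IH divnS// addnC addnS.
Qed.

(** A period costs n for its full gradient, which spread over p >= n^(1/2) rounds
    is at most n^(1/2) per round, the order of the cost of the other rounds. The last,
    possibly incomplete period accounts for the additive n. *)
Lemma ifo_le {R : realType} M n p T : (0 < M)%N -> (0 < p)%N ->
  Num.sqrt n%:R <= p%:R :> R ->
  ifo_per_worker M n p T <= Num.sqrt n%:R * (3 * T%:R + Num.sqrt n%:R) :> R.
Proof.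
move=> M0 p0 np; set r := Num.sqrt n%:R; have r0 : 0 <= r := sqrtr_ge0 _.
have rr : r * r = n%:R by rewrite -expr2 sqr_sqrtr.
have pR : 0 < p%:R :> R by rewrite ltr0n.
rewrite /ifo_per_worker; apply: (@le_trans _ _
  (\sum_(t < T) (n%:R * (p %| t)%:R + 2 * r))).
  apply: ler_sum => t _; case: ifP => _; first by rewrite mulr1 lerDl mulr_ge0.
  rewrite mulr0 add0r ler_pM2l//.
  by rewrite ler_piMr ?sqrtr_ge0// invf_le1 ?ltr0n// ler1n.
rewrite big_split /= -mulr_sumr -natr_sum sumr_const card_ord -mulr_natl.
have cnt : (\sum_(t < T) (p %| t : nat))%N%:R <= T%:R / p%:R + 1 :> R.
  apply: le_trans (_ : (T %/ p).+1%:R <= _); first by rewrite ler_nat count_multiples.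
  by rewrite -natr1 lerD2r ler_pdivlMr// -natrM ler_nat leq_trunc_div.
have np' : n%:R * (T%:R / p%:R) <= r * T%:R.
  rewrite mulrCA mulrC ler_wpM2r// ler_pdivrMr// -rr.
  by rewrite ler_wpM2l.
have : n%:R * (\sum_(t < T) (p %| t : nat))%N%:R <= n%:R * (T%:R / p%:R + 1) :> R.
  by rewrite ler_wpM2l.
by move: np'; rewrite -rr; lra.
Qed.

Section Levels.
Context {R : realType}.
Implicit Types (X Y a : R) (s : nat).

(** A squared level of at least d Y makes the factor d of the dimension
    disappear from the quantization error. *)
Lemma level_error_le (d : nat) X Y a : 0 <= X -> 0 < Y -> 0 < a -> d%:R * Y <= a ->
  d%:R * (X / a) <= X / Y.
Proof.
move=> X0 Y0 a0 da; rewrite mulrCA ler_wpM2l// ler_pdivrMr// mulrC ler_pdivlMr//.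
Qed.

Lemma sqr_fourth_root (n : nat) : ((n%:R : R) `^ 4^-1) ^+ 2 = Num.sqrt n%:R.
Proof.
rewrite -powR_mulrn ?powR_ge0// -powRrM -powR12_sqrt//; congr (_ `^ _).
by field.
Qed.

End Levels.

Theorem corollary4p4p1 (R : realType) (M0 L D Ginf : R) :
  exists2 C : R, 0 < C &
  forall (M n d : nat) (K : set 'rV[R]_d) (f : 'I_M -> 'I_n -> 'rV[R]_d -> R),
    (0 < M)%N -> (0 < n)%N -> (0 < d)%N ->
    convex_set K -> compact K -> diameter K = D ->
    (forall m j, smooth_on L K (f m j)) ->
    (forall m j x, K x -> `|f m j x| <= M0) ->
    (forall m j x, K x -> `|grad (f m j) x| <= Ginf) ->
  let p := round_up (Num.sqrt n%:R : R) in
  let S := round_up (Num.sqrt n%:R / M%:R : R) in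
  \forall eps \near (0 : R)^'+, exists T : nat,
    let eta := fun _ : nat => (Num.sqrt T%:R : R)^-1 in
    let s1 := fun t : nat =>
      if (p %| t)%N then round_up (Num.sqrt ((T * d)%:R / M%:R) : R)
      else round_up (Num.sqrt d%:R * n%:R `^ 4^-1 / Num.sqrt M%:R : R) in
    let s2 := fun t : nat =>
      if (p %| t)%N then round_up (Num.sqrt (T * d)%:R : R)
      else round_up (Num.sqrt d%:R * n%:R `^ 4^-1 : R) in
    [/\ (0 < T)%N,
        T%:R <= C / eps ^+ 2,
        ifo_per_worker M n p T
          <= C * (Num.sqrt (M * n)%:R / (eps ^+ 2 * Num.sqrt M%:R)) &
        forall (disp : measure_display) (Omega : measurableType disp)
          (P : probability Omega R) (x1 : 'rV[R]_d)
          (W : nat -> Omega -> @choices M n d S)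
          (x gbar v : nat -> Omega -> 'rV[R]_d)
          (out : Omega -> 'I_T),
          K x1 ->
          qfw_run K f p eta s1 s2 P x1 W x gbar v out ->
          ('E_P[fun om => fw_gap K (objective f) (x (out om) om)] <= eps%:E)%E].
Proof.
(* A positive smoothness constant avoids the degenerate cases L <= 0. *)
pose Lp := `|L| + 1; have Lp0 : 0 < Lp by rewrite ltr_wpDl.
(* sigma2 / T bounds the expected squared error of the gradient estimates. *)
pose sigma2 := 2 * Ginf ^+ 2 + 6 * (Lp ^+ 2 * D ^+ 2).
have sigma2_ge0 : 0 <= sigma2 
  by apply: addr_ge0; rewrite pmulr_rge0// -?exprMn sqr_ge0.
(* The expected gap will be at most A / T^(1/2). *)
pose A := 2 * `|M0| + (Lp + 2^-1) * D ^+ 2 + 2^-1 * sigma2 + 1.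
have A1 : 1 <= A.
  have LD0 : 0 <= (Lp + 2^-1) * D ^+ 2.
    by rewrite mulr_ge0 ?sqr_ge0// addr_ge0 ?invr_ge0// ltW.
  have := normr_ge0 M0; rewrite /A; move: LD0 sigma2_ge0; lra.
have A0 : 0 < A by apply: lt_le_trans A1.
have AA : 1 <= A ^+ 2 by rewrite expr_ge1// ltW.
(* With T <= 2 A^2 / eps^2 the bound n^(1/2) (3 T + n^(1/2)) on the IFO cost
   gives the factor 7 = 3 * 2 + 1. *)
exists (7 * A ^+ 2) => [|M n d K f hM hn hd Kc Kcpt KD fs fb fg p S].
  by rewrite mulr_gt0 ?exprn_gt0.
have nR : 1 <= n%:R :> R by rewrite ler1n.
have n_gt0 : 0 < n%:R :> R by rewrite ltr0n.
have MR : 0 < M%:R :> R by rewrite ltr0n.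
have dR : 0 < d%:R :> R by rewrite ltr0n.
pose r : R := Num.sqrt n%:R.
have rr : r * r = n%:R by rewrite -expr2 sqr_sqrtr.
have r1 : 1 <= r by rewrite -[X in X <= _]sqrtr1 ler_sqrt.
have r0 : 0 < r by apply: lt_le_trans r1.
have p_gt0 : (0 < p)%N := round_up_gt0 _.
have rp : r <= p%:R := round_up_ge _.
have pr : p%:R <= 2 * r.
  by apply: le_trans (round_up_le (ltW r0)) _; rewrite mulrDl mul1r lerD2l.
near=> eps.
have eps0 : 0 < eps by near: eps; exact: nbhs_right_gt.
(* Small enough for the n gradients of one period to cost at most
   n^(1/2) / eps^2. *)
have eps_n : eps <= n%:R^-1.
  by near: eps; apply: nbhs_right_le; rewrite invr_gt0.
have eps1 : eps <= 1 by apply: le_trans eps_n _; rewrite invf_le1.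
have eps2 : 0 < eps ^+ 2 by rewrite exprn_gt0.
have r_eps : r * eps ^+ 2 <= 1.
  apply: (@le_trans _ _ (n%:R * eps)); last first.
    by rewrite -ler_pdivlMl// mulr1.
  rewrite -rr -mulrA ler_pM2l// expr2 ler_pM2r//.
  exact: le_trans eps1 r1.
pose T := round_up (A ^+ 2 / eps ^+ 2).
have T0 : (0 < T)%N := round_up_gt0 _.
have TR : 0 < T%:R :> R by rewrite ltr0n.
have T_ge : A ^+ 2 / eps ^+ 2 <= T%:R := round_up_ge _.
have Aeps : 1 <= A ^+ 2 / eps ^+ 2.
  by rewrite ler_pdivlMr// mul1r (le_trans _ AA)// expr_le1// ltW.
have T_le : T%:R <= 2 * (A ^+ 2 / eps ^+ 2).
  have := round_up_le (le_trans ler01 Aeps); rewrite -/T; lra.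
pose s1 t := if (p %| t)%N then round_up (Num.sqrt ((T * d)%:R / M%:R) : R)
  else round_up (Num.sqrt d%:R * n%:R `^ 4^-1 / Num.sqrt M%:R : R).
pose s2 t := if (p %| t)%N then round_up (Num.sqrt (T * d)%:R : R)
  else round_up (Num.sqrt d%:R * n%:R `^ 4^-1 : R).
exists T; split => //.
- have -> : 7 * A ^+ 2 / eps ^+ 2 = 7 * (A ^+ 2 / eps ^+ 2) by ring.
  by move: T_le Aeps; lra.
- apply: le_trans (ifo_le _ hM p_gt0 rp) _; rewrite -/r.
  have -> : Num.sqrt (M * n)%:R / (eps ^+ 2 * Num.sqrt M%:R) = r / eps ^+ 2.
    rewrite natrM sqrtrM// -/r; field.
    by rewrite gt_eqF// gt_eqF// sqrtr_gt0.
  have r_le : r <= (eps ^+ 2)^-1 by rewrite -[leRHS]mul1r ler_pdivlMr.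
  have Ar_le : (eps ^+ 2)^-1 <= A ^+ 2 / eps ^+ 2.
    by rewrite -[leLHS]mul1r ler_pM2r ?invr_gt0.
  have -> : 7 * A ^+ 2 * (r / eps ^+ 2) = r * (7 * (A ^+ 2 / eps ^+ 2)) by ring.
  by rewrite ler_pM2l//; lra.
move=> disp Omega P x1 W x gbar v out Kx1 run.
(* V bounds the squared gradient difference along one step of length at most
   D / T^(1/2). *)
pose V := Lp ^+ 2 * ((Num.sqrt T%:R : R)^-1 ^+ 2 * D ^+ 2).
have V0 : 0 <= V by rewrite /V -!exprMn sqr_ge0.
have sT : (Num.sqrt T%:R : R) ^+ 2 = T%:R by rewrite sqr_sqrtr.
pose a := 2 * (Ginf ^+ 2 / T%:R).
pose b := 3 * (V / r).
have b0 : 0 <= b by rewrite mulr_ge0// divr_ge0// ltW.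
have s1_gt0 t : (0 < s1 t)%N by rewrite /s1; case: ifP => _; exact: round_up_gt0.
have s2_gt0 t : (0 < s2 t)%N by rewrite /s2; case: ifP => _; exact: round_up_gt0.
have sqr_le (y z : R) : 0 <= y -> y <= z -> y ^+ 2 <= z ^+ 2.
  by move=> y0 yz; rewrite lerXn2r// nnegrE// (le_trans y0).
have s1_sqr t : 0 < M%:R * (s1 t)%:R ^+ 2 :> R by rewrite mulr_gt0 ?exprn_gt0 ?ltr0n.
have s2_sqr t : 0 < (s2 t)%:R ^+ 2 :> R by rewrite exprn_gt0 ?ltr0n.
have a_ge t : (p %| t)%N ->
    d%:R * (Ginf ^+ 2 / (M%:R * (s1 t)%:R ^+ 2) + Ginf ^+ 2 / (s2 t)%:R ^+ 2) <= a.
  move=> pt; rewrite mulrDr /a mulrDl mul1r; apply: lerD.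
    apply: level_error_le; rewrite ?sqr_ge0// -ler_pdivrMl// /s1 pt.
    apply: le_trans (sqr_le _ _ (sqrtr_ge0 _) (round_up_ge _)).
    by rewrite sqr_sqrtr ?divr_ge0// natrM mulrC [_ * d%:R]mulrC.
  apply: level_error_le; rewrite ?sqr_ge0// /s2 pt.
  apply: le_trans (sqr_le _ _ (sqrtr_ge0 _) (round_up_ge _)).
  by rewrite sqr_sqrtr// natrM mulrC.
have b_ge t : ~~ (p %| t)%N ->
    V / (M * S)%:R + d%:R * (V / (M%:R * (s1 t)%:R ^+ 2) + V / (s2 t)%:R ^+ 2) <= b.
  move=> /negbTE pt; have -> : b = V / r + (V / r + V / r) by rewrite /b; ring.
  have n4 : (n%:R `^ 4^-1 : R) ^+ 2 = r by exact: sqr_fourth_root.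
  rewrite mulrDr; apply: lerD; [|apply: lerD].
  - rewrite ler_wpM2l// lef_pV2 ?posrE//; last first.
      by rewrite ltr0n muln_gt0 hM round_up_gt0.
    by rewrite natrM -ler_pdivrMl// mulrC round_up_ge.
  - apply: level_error_le => //; rewrite -ler_pdivrMl// /s1 pt.
    apply: le_trans (sqr_le _ _ _ (round_up_ge _)).
      by rewrite !exprMn exprVn !sqr_sqrtr// n4 mulrC.
    by rewrite !mulr_ge0 ?invr_ge0 ?sqrtr_ge0 ?powR_ge0.
  - apply: level_error_le => //; rewrite /s2 pt.
    apply: le_trans (sqr_le _ _ _ (round_up_ge _)).
      by rewrite exprMn sqr_sqrtr// n4.
    by rewrite !mulr_ge0 ?sqrtr_ge0 ?powR_ge0.
have K_diam y z : K y -> K z -> dotp (y - z) (y - z) <= D ^+ 2.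
  by rewrite -KD; exact: compact_dist_le_diameter.
have fs' m j : smooth_on Lp K (f m j) by exact: smooth_on_pos.
have S0 : (0 < S)%N := round_up_gt0 _.
apply: le_trans (expected_gap_bound hM hn S0 T0 Lp0 Kc fs' fb fg K_diam
  s1_gt0 s2_gt0 a_ge b_ge b0 p_gt0 Kx1 run) _.
rewrite lee_fin ler_pdivrMr ?sqrtr_gt0//.
have err : T%:R * (a + p%:R * b) <= sigma2.
  have : p%:R * b <= 2 * r * b by rewrite ler_wpM2r.
  have -> : 2 * r * b = 6 * V by rewrite /b; field; rewrite gt_eqF.
  rewrite -(ler_pM2l TR) mulrDr.
  have -> : T%:R * (6 * V) = 6 * (Lp ^+ 2 * D ^+ 2).
    by rewrite /V exprVn sT; field; rewrite gt_eqF.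
  have -> : T%:R * a = 2 * Ginf ^+ 2 by rewrite /a; field; rewrite gt_eqF.
  by rewrite /sigma2 lerD2l.
have A_le : A <= eps * Num.sqrt T%:R.
  have AT : A / eps <= Num.sqrt T%:R.
    rewrite -(ger0_norm (divr_ge0 (ltW A0) (ltW eps0))) -sqrtr_sqr ler_wsqrtr//.
    by rewrite exprMn exprVn.
  by rewrite mulrC -ler_pdivrMr.
apply: le_trans A_le; rewrite /A; have := ler_norm M0; move: err; lra.
Unshelve. all: by end_near.
Qed.
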